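(* Let $\tau\in\mathbb{C}$ with $\mathrm{Im}(\tau)>0$, let $q=e^{\pi i\tau}$ and $\tau'=-1/\tau$. For every complex number $z$, \[ \theta_1(3z\mid\tau')\,\theta_1^3\!\left(\tfrac{\pi}{2}\,\big|\,\tfrac{\tau'}{3}\right)\theta_1\!\left(\tfrac{\pi}{2}\,\big|\,\tfrac{\tau'}{9}\right) =\frac13\frac{\Pi_q}{\Pi_{q^9}}\,\theta_1\!\left(z\,\big|\,\tfrac{\tau'}{9}\right)\theta_1\!\left(\tfrac{\pi}{2}\,\big|\,\tau'\right)\theta_1^3\!\left(\tfrac{\pi}{2}\,\big|\,\tfrac{\tau'}{3}\right) -\left(\frac13\frac{\Pi_q}{\Pi_{q^9}}+1\right)\theta_1^3\!\left(z\,\big|\,\tfrac{\tau'}{3}\right)\theta_1\!\left(\tfrac{\pi}{2}\,\big|\,\tau'\right)\theta_1\!\left(\tfrac{\pi}{2}\,\big|\,\tfrac{\tau'}{9}\right). \]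
   Context: For $\sigma\in\mathbb{C}$ with $\mathrm{Im}(\sigma)>0$ and $z\in\mathbb{C}$, the first Jacobi theta function is \[ \theta_1(z\mid\sigma)=2\sum_{n=0}^{\infty}(-1)^n e^{\pi i\sigma(2n+1)^2/4}\sin((2n+1)z), \] and $\theta_1^m(z\mid\sigma)$ denotes its $m$-th power. For $|q|<1$, $(a;q)_\infty=\prod_{i=0}^{\infty}(1-aq^i)$. With $q=e^{\pi i\tau}$, \[ \Pi_q=q^{1/4}\frac{(q^2;q^2)_\infty^2}{(q;q^2)_\infty^2}, \] and for a positive integer $m$, $\Pi_{q^m}$ is the same expression with $q$ replaced by $q^m=e^{\pi i m\tau}$ (that is, $\tau$ replaced by $m\tau$). Fractional powers of $q$ are understood as $q^a=e^{\pi i\tau a}$. *)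

(* Defs.v *)
(* Stdlib reals and Coquelicot complex numbers. *)
From Stdlib Require Import Reals.
From Coquelicot Require Import Coquelicot.

Local Open Scope C_scope.

(* Coquelicot's [lim] in the complete space C: the limit when it exists, see
   [Clim_seq_unique], and unspecified otherwise. *)
Definition Clim_seq (u : nat -> C) : C :=
  @lim C_CompleteNormedModule (filtermap u eventually).

Lemma Clim_seq_unique (u : nat -> C) (l : C) :
  filterlim u eventually (@locally C_UniformSpace l) -> Clim_seq u = l.
Proof.
intros Hu.
assert (HF : ProperFilter (filtermap u eventually)).
{ apply filtermap_proper_filter, eventually_filter. }
apply (filterlim_locally_unique (K := C_AbsRing) (V := C_NormedModule)
         (F := filtermap u eventually) (fun x : C => x)).
- intros P HP.
  destruct HP as [eps Heps].
  refine (filter_imp _ _ _ (complete_cauchy (T := C_CompleteNormedModule)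
            (filtermap u eventually) HF _ eps)).
  + intros x Hx. exact (Heps x Hx).
  + intros e. exists l. exact (Hu _ (locally_ball (T := C_UniformSpace) l e)).
- exact Hu.
Qed.

Definition CSeries (a : nat -> C) : C := Clim_seq (fun n => sum_n a n).

(* Product of the f i for i < n. *)
Fixpoint Cprod (f : nat -> C) (n : nat) : C :=
  match n with
  | O => 1
  | S k => Cprod f k * f k
  end.

Definition Cexp (z : C) : C :=
  (exp (Re z) * cos (Im z), exp (Re z) * sin (Im z))%R.

Definition Csin (z : C) : C := (Cexp (Ci * z) - Cexp (- (Ci * z))) / (2 * Ci).

Definition theta1 (z sigma : C) : C :=
  2 * CSeries (fun n : nat =>
        let k : C := INR (2 * n + 1) in
        (- (1)) ^ n * Cexp (PI * Ci * sigma * k ^ 2 / 4) * Csin (k * z)).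

Definition qPochhammer (a q : C) : C :=
  Clim_seq (Cprod (fun i : nat => 1 - a * q ^ i)).

(* With q = e^(pi i tau), [qpow tau a] is the branch e^(pi i tau a) of q^a. *)
Definition qpow (tau a : C) : C := Cexp (PI * Ci * tau * a).

Definition nome (tau : C) : C := Cexp (PI * Ci * tau).

(* Pi_q as a function of tau, since q^(1/4) depends on the choice of tau and
   not only on q; hence Pi_(q^m) is [PiQ (m * tau)]. *)
Definition PiQ (tau : C) : C :=
  let q := nome tau in
  qpow tau (1 / 4) *
    (qPochhammer (q ^ 2) (q ^ 2) ^ 2 / qPochhammer q (q ^ 2) ^ 2).

(* Main.v *)
Require Import Defs.
From Stdlib Require Import Reals Lra Lia Psatz List ZArith FunctionalExtensionality.
From Coquelicot Require Import Coquelicot.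
Local Open Scope C_scope.

(** Put sigma = tau'/9, so that tau'/3 = 3 sigma and tau' = 9 sigma. As functions of
    z, theta_1(3z | 9 sigma), theta_1(z | sigma) and theta_1(z | 3 sigma)^3 are odd
    theta functions of order 3 with the same antiperiod pi and the same multiplier
    for the quasi-period 3 pi sigma. Such functions form a plane, so the three are
    dependent, and as theta_1(z | sigma) has a simple zero at 0 and the cube a triple
    one, the relation can be solved for the first:

      theta_1(3z | 9 sigma) = a theta_1(z | sigma) + b theta_1(z | 3 sigma)^3.

    The cube vanishes to third order at 0, so the first order terms at 0 give a, and
    the values at pi/2 then give b. What results is the identity with the
    coefficient A = 3 R(9 sigma) / R(sigma) in the place of Pi_q / (3 Pi_(q^9)),
    where R(s) is the quotient of theta_1'(0 | s) by theta_1(pi/2 | s). Inversion of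
    the modulus gives R(-1/tau) = - 2 i tau Pi_q, and applying this to tau and to
    9 tau evaluates A.

    Both the plane and the inversion formula come from one uniqueness theorem
    (theta_fun_zero): a theta function of order k vanishes as soon as k consecutive
    Fourier coefficients do. Its proof moves the line of integration along the
    quasi-period by Cauchy's theorem (cint_shift), which relates the coefficients of
    index n and n + k, and then uses that a periodic entire function without
    nonzero Fourier coefficients is zero (fourier_unique).

    For k = 1 it says that theta functions of order 1 with equal multipliers are
    proportional. This yields the product formula for theta_1 up to a constant
    (theta1_prod), and also, up to a constant, the modular transformation of the
    product: the product for -1/tau at z/tau, times a Gaussian factor, is a multiple
    of the product for tau. Comparing that multiple at 0 and at pi tau / 2 eliminates
    the constant and produces exactly the infinite products in Pi_q
    (theta_cofactor_modular). The constants of the product formulas cancel because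
    the statement is homogeneous in each of the theta functions. *)

(** * Entire functions as locally uniform limits of polynomials *)

Fixpoint peval (p : list C) (z : C) : C :=
  match p with
  | nil => 0
  | a :: p' => a + z * peval p' z
  end.

(** Polynomial approximation on discs instead of differentiability: in this form
    the class is visibly closed under products, composition and locally uniform
    limits, and Cauchy's theorem reduces to polynomials. *)
Definition entire (f : C -> C) : Prop :=
  forall r eps : R, (0 < eps)%R ->
  exists p, forall z, (Cmod z <= r)%R -> (Cmod (f z - peval p z) <= eps)%R.

Lemma entire_ext (f g : C -> C) :
  (forall z, f z = g z) -> entire f -> entire g.
Proof.
intros E Hf r eps He. destruct (Hf r eps He) as [p Hp].
exists p. intros z Hz. rewrite <- E. auto.
Qed.

Lemma entire_peval p : entire (peval p).
Proof.
intros r eps He. exists p. intros z _.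
replace (peval p z - peval p z) with (RtoC 0) by ring. rewrite Cmod_0. lra.
Qed.

Lemma entire_const c : entire (fun _ => c).
Proof.
apply (entire_ext (peval (c :: nil))); [intros z; simpl; ring | apply entire_peval].
Qed.

Lemma entire_id : entire (fun z => z).
Proof.
apply (entire_ext (peval (RtoC 0 :: RtoC 1 :: nil)));
  [intros z; simpl; ring | apply entire_peval].
Qed.

Fixpoint padd (p q : list C) : list C :=
  match p, q with
  | nil, _ => q
  | _, nil => p
  | a :: p', b :: q' => (a + b) :: padd p' q'
  end.

Lemma peval_padd p q z : peval (padd p q) z = peval p z + peval q z.
Proof.
revert q; induction p as [|a p IH]; intros [|b q]; simpl; try ring.
rewrite IH; ring.
Qed.

Lemma peval_scal c p z : peval (map (Cmult c) p) z = c * peval p z.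
Proof. induction p as [|a p IH]; simpl; [ring|]. rewrite IH; ring. Qed.

Fixpoint pmul (p q : list C) : list C :=
  match p with
  | nil => nil
  | a :: p' => padd (map (Cmult a) q) (RtoC 0 :: pmul p' q)
  end.

Lemma peval_pmul p q z : peval (pmul p q) z = peval p z * peval q z.
Proof.
induction p as [|a p IH]; simpl; [ring|].
rewrite peval_padd, peval_scal. simpl. rewrite IH; ring.
Qed.

Lemma peval_bounded p r :
  exists M, (0 < M)%R /\ forall z, (Cmod z <= r)%R -> (Cmod (peval p z) <= M)%R.
Proof.
induction p as [|a p [M [HM IH]]].
- exists 1%R. split; [lra|]. intros z _. simpl. rewrite Cmod_0. lra.
- exists (Cmod a + Rabs r * M + 1)%R. split.
  + generalize (Cmod_ge_0 a) (Rabs_pos r). nra.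
  + intros z Hz. simpl. eapply Rle_trans; [apply Cmod_triangle|].
    rewrite Cmod_mult. generalize (IH z Hz) (Cmod_ge_0 z) (RRle_abs r)
      (Cmod_ge_0 (peval p z)). nra.
Qed.

Lemma entire_bounded f r : entire f ->
  exists M, (0 < M)%R /\ forall z, (Cmod z <= r)%R -> (Cmod (f z) <= M)%R.
Proof.
intros Hf. destruct (Hf r 1%R Rlt_0_1) as [p Hp].
destruct (peval_bounded p r) as [M [HM HB]].
exists (1 + M)%R. split; [lra|]. intros z Hz.
replace (f z) with ((f z - peval p z) + peval p z) by ring.
eapply Rle_trans; [apply Cmod_triangle|]. specialize (Hp z Hz). specialize (HB z Hz). lra.
Qed.

Lemma entire_plus f g : entire f -> entire g -> entire (fun z => f z + g z).
Proof.
intros Hf Hg r eps He.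
destruct (Hf r (eps / 2)%R) as [p Hp]; [lra|].
destruct (Hg r (eps / 2)%R) as [q Hq]; [lra|].
exists (padd p q). intros z Hz. rewrite peval_padd.
replace (f z + g z - (peval p z + peval q z))
  with ((f z - peval p z) + (g z - peval q z)) by ring.
eapply Rle_trans; [apply Cmod_triangle|]. specialize (Hp z Hz). specialize (Hq z Hz). lra.
Qed.

Lemma entire_mult f g : entire f -> entire g -> entire (fun z => f z * g z).
Proof.
intros Hf Hg r eps He.
destruct (entire_bounded f r Hf) as [M [HM HB]].
destruct (Hg r (eps / 2 / M)%R) as [q Hq]; [apply Rdiv_lt_0_compat; lra|].
destruct (peval_bounded q r) as [N [HN HNB]].
destruct (Hf r (eps / 2 / N)%R) as [p Hp]; [apply Rdiv_lt_0_compat; lra|].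
exists (pmul p q). intros z Hz. rewrite peval_pmul.
replace (f z * g z - peval p z * peval q z)
  with (f z * (g z - peval q z) + (f z - peval p z) * peval q z) by ring.
eapply Rle_trans; [apply Cmod_triangle|]. rewrite !Cmod_mult.
specialize (Hp z Hz). specialize (Hq z Hz). specialize (HB z Hz). specialize (HNB z Hz).
assert (Cmod (f z) * Cmod (g z - peval q z) <= M * (eps / 2 / M))%R
  by (apply Rmult_le_compat; auto; apply Cmod_ge_0).
assert (Cmod (f z - peval p z) * Cmod (peval q z) <= (eps / 2 / N) * N)%R
  by (apply Rmult_le_compat; auto; apply Cmod_ge_0).
replace (M * (eps / 2 / M))%R with (eps / 2)%R in * by (field; lra).
replace ((eps / 2 / N) * N)%R with (eps / 2)%R in * by (field; lra).
lra.
Qed.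

Lemma entire_scal c f : entire f -> entire (fun z => c * f z).
Proof. intros Hf. apply (entire_mult (fun _ => c)); auto using entire_const. Qed.

Lemma entire_minus f g : entire f -> entire g -> entire (fun z => f z - g z).
Proof.
intros Hf Hg. apply (entire_ext (fun z => f z + (- (1)) * g z)).
- intros z; ring.
- apply entire_plus; auto using entire_scal.
Qed.

Lemma entire_pow f n : entire f -> entire (fun z => f z ^ n).
Proof.
intros Hf. induction n as [|n IH]; simpl.
- apply entire_const.
- apply entire_mult; auto.
Qed.

Lemma entire_limit f :
  (forall r eps : R, (0 < eps)%R -> exists g, entire g /\
     forall z, (Cmod z <= r)%R -> (Cmod (f z - g z) <= eps)%R) ->
  entire f.
Proof.
intros H r eps He.
destruct (H r (eps / 2)%R) as [g [Hg Hfg]]; [lra|].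
destruct (Hg r (eps / 2)%R) as [p Hp]; [lra|].
exists p. intros z Hz.
replace (f z - peval p z) with ((f z - g z) + (g z - peval p z)) by ring.
eapply Rle_trans; [apply Cmod_triangle|]. specialize (Hp z Hz). specialize (Hfg z Hz). lra.
Qed.

Lemma entire_comp g f : entire g -> entire f -> entire (fun z => g (f z)).
Proof.
intros Hg Hf. apply entire_limit. intros r eps He.
destruct (entire_bounded f r Hf) as [M [HM HB]].
destruct (Hg M eps He) as [p Hp].
exists (fun z => peval p (f z)). split; [|auto].
clear - Hf. induction p as [|a p IH]; simpl.
- apply entire_const.
- apply entire_plus; [apply entire_const|]. apply entire_mult; auto.
Qed.

Lemma entire_affine a d : entire (fun z => a + d * z).
Proof. apply entire_plus; [apply entire_const | apply entire_scal, entire_id]. Qed.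

Lemma peval_lipschitz p r :
  exists L, (0 < L)%R /\ forall z w, (Cmod z <= r)%R -> (Cmod w <= r)%R ->
    (Cmod (peval p z - peval p w) <= L * Cmod (z - w))%R.
Proof.
induction p as [|a p [L [HL IH]]].
- exists 1%R. split; [lra|]. intros z w _ _. simpl.
  replace (RtoC 0 - RtoC 0) with (RtoC 0) by ring. rewrite Cmod_0.
  generalize (Cmod_ge_0 (z - w)). lra.
- destruct (peval_bounded p r) as [M [HM HB]].
  exists (M + Rabs r * L)%R. split; [generalize (Rabs_pos r); nra|].
  intros z w Hz Hw. simpl.
  replace (a + z * peval p z - (a + w * peval p w))
    with ((z - w) * peval p z + w * (peval p z - peval p w)) by ring.
  eapply Rle_trans; [apply Cmod_triangle|]. rewrite !Cmod_mult.
  specialize (IH z w Hz Hw). specialize (HB z Hz).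
  assert (Cmod (z - w) * Cmod (peval p z) <= Cmod (z - w) * M)%R
    by (apply Rmult_le_compat_l; auto; apply Cmod_ge_0).
  assert (Cmod w * Cmod (peval p z - peval p w) <= Rabs r * (L * Cmod (z - w)))%R.
  { apply Rmult_le_compat; auto using Cmod_ge_0. eapply Rle_trans; [exact Hw|apply RRle_abs]. }
  lra.
Qed.

Lemma entire_continuous f z eps : entire f -> (0 < eps)%R ->
  exists del, (0 < del)%R /\
    forall w, (Cmod (w - z) < del)%R -> (Cmod (f w - f z) < eps)%R.
Proof.
intros Hf He.
destruct (Hf (Cmod z + 1)%R (eps / 4)%R) as [p Hp]; [lra|].
destruct (peval_lipschitz p (Cmod z + 1)) as [L [HL HLip]].
exists (Rmin 1 (eps / 4 / L)). split.
{ apply Rmin_glb_lt; [lra|]. apply Rdiv_lt_0_compat; lra. }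
intros w Hw.
assert (H1 := Rlt_le_trans _ _ _ Hw (Rmin_l _ _)).
assert (H2 := Rlt_le_trans _ _ _ Hw (Rmin_r _ _)).
assert (Hzr : (Cmod z <= Cmod z + 1)%R) by lra.
assert (Hwr : (Cmod w <= Cmod z + 1)%R).
{ replace w with (z + (w - z)) at 1 by ring.
  eapply Rle_trans; [apply Cmod_triangle|]. lra. }
replace (f w - f z) with ((f w - peval p w) + ((peval p w - peval p z) + - (f z - peval p z)))
  by ring.
eapply Rle_lt_trans; [apply Cmod_triangle|].
eapply Rle_lt_trans; [apply Rplus_le_compat_l, Cmod_triangle|].
rewrite Cmod_opp.
generalize (Hp w Hwr) (Hp z Hzr) (HLip w z Hwr Hzr). intros A B D.
assert (L * Cmod (w - z) <= L * (eps / 4 / L))%R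
  by (apply Rmult_le_compat_l; lra).
replace (L * (eps / 4 / L))%R with (eps / 4)%R in * by (field; lra).
lra.
Qed.

Lemma entire_real_continuous f : entire f -> forall x : R,
  continuous (fun t : R => Re (f t)) x /\ continuous (fun t : R => Im (f t)) x.
Proof.
intros Hf x.
assert (K : forall eps : posreal, exists d : posreal, forall t : R,
  (Rabs (t - x) < d)%R -> (Cmod (f t - f x) < eps)%R).
{ intros eps. destruct (entire_continuous f x eps Hf (cond_pos eps)) as [d [Hd H]].
  exists (mkposreal d Hd). intros t Ht. apply H.
  rewrite <- RtoC_minus, Cmod_R. exact Ht. }
split; intros P [eps HP]; destruct (K eps) as [d Hd]; exists d; intros t Ht; apply HP;
  specialize (Hd t Ht); eapply Rle_lt_trans; try exact Hd;
  (eapply Rle_trans; [|apply Rmax_Cmod]); [apply Rmax_l | apply Rmax_r].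
Qed.

(** * The integral over the unit interval and Cauchy's theorem *)

Definition cint (f : C -> C) : C :=
  (RInt (fun x : R => Re (f x)) 0 1, RInt (fun x : R => Im (f x)) 0 1).

Lemma entire_ex_RInt f a b : entire f ->
  ex_RInt (fun x : R => Re (f x)) a b /\ ex_RInt (fun x : R => Im (f x)) a b.
Proof.
intros Hf. split; apply (ex_RInt_continuous (V := R_CompleteNormedModule));
  intros x _; apply (entire_real_continuous f Hf x).
Qed.

Lemma cint_ext (f g : C -> C) : (forall x : R, f x = g x) -> cint f = cint g.
Proof.
intros E. unfold cint. f_equal; apply RInt_ext; intros x _; rewrite E; reflexivity.
Qed.

Lemma cint_plus f g : entire f -> entire g ->
  cint (fun z => f z + g z) = cint f + cint g.
Proof.
intros Hf Hg.
destruct (entire_ex_RInt f 0 1 Hf) as [F1 F2], (entire_ex_RInt g 0 1 Hg) as [G1 G2].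
apply injective_projections; simpl.
- exact (RInt_plus (V := R_CompleteNormedModule) _ _ 0 1 F1 G1).
- exact (RInt_plus (V := R_CompleteNormedModule) _ _ 0 1 F2 G2).
Qed.

Lemma cint_scal c f : entire f -> cint (fun z => c * f z) = c * cint f.
Proof.
intros Hf. destruct (entire_ex_RInt f 0 1 Hf) as [H1 H2].
assert (S1 : forall k, ex_RInt (fun x : R => k * Re (f x))%R 0 1)
  by (intros k; exact (ex_RInt_scal (V := R_NormedModule) _ 0 1 k H1)).
assert (S2 : forall k, ex_RInt (fun x : R => k * Im (f x))%R 0 1)
  by (intros k; exact (ex_RInt_scal (V := R_NormedModule) _ 0 1 k H2)).
assert (V1 : forall k, RInt (fun x : R => k * Re (f x))%R 0 1 = (k * RInt (fun x : R => Re (f x)) 0 1)%R)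
  by (intros k; exact (RInt_scal (V := R_CompleteNormedModule) _ 0 1 k H1)).
assert (V2 : forall k, RInt (fun x : R => k * Im (f x))%R 0 1 = (k * RInt (fun x : R => Im (f x)) 0 1)%R)
  by (intros k; exact (RInt_scal (V := R_CompleteNormedModule) _ 0 1 k H2)).
apply injective_projections; simpl.
- rewrite <- V1, <- V2.
  exact (RInt_minus (V := R_CompleteNormedModule) _ _ 0 1 (S1 _) (S2 _)).
- rewrite <- V1, <- V2.
  exact (RInt_plus (V := R_CompleteNormedModule) _ _ 0 1 (S2 _) (S1 _)).
Qed.

Lemma Cmod_le_Re_Im c : (Cmod c <= Rabs (Re c) + Rabs (Im c))%R.
Proof.
destruct c as [x y]. replace (x, y) with (RtoC x + Ci * RtoC y)
  by (apply injective_projections; simpl; ring).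
eapply Rle_trans; [apply Cmod_triangle|].
rewrite Cmod_mult, Cmod_Ci, !Cmod_R. simpl.
replace (x + (0 * y - 1 * 0))%R with x by ring.
replace (0 + (0 * 0 + 1 * y))%R with y by ring. lra.
Qed.

Lemma Im_le_Cmod c : (Rabs (Im c) <= Cmod c)%R.
Proof. eapply Rle_trans; [apply Rmax_r | apply Rmax_Cmod]. Qed.

Lemma cint_bound f M : entire f ->
  (forall x : R, (0 <= x <= 1)%R -> (Cmod (f x) <= M)%R) -> (Cmod (cint f) <= 2 * M)%R.
Proof.
intros Hf HM. destruct (entire_ex_RInt f 0 1 Hf) as [H1 H2].
eapply Rle_trans; [apply Cmod_le_Re_Im|]. simpl.
assert (Rabs (RInt (fun x : R => Re (f x)) 0 1) <= (1 - 0) * M)%R.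
{ apply abs_RInt_le_const; [lra|exact H1|]. intros t Ht.
  eapply Rle_trans; [apply re_le_Cmod | auto]. }
assert (Rabs (RInt (fun x : R => Im (f x)) 0 1) <= (1 - 0) * M)%R.
{ apply abs_RInt_le_const; [lra|exact H2|]. intros t Ht.
  eapply Rle_trans; [apply Im_le_Cmod | auto]. }
lra.
Qed.

Definition cderiv (g : R -> C) (x : R) (l : C) : Prop :=
  is_derive (fun t => Re (g t)) x (Re l) /\ is_derive (fun t => Im (g t)) x (Im l).

Lemma cderiv_plus g h x l m : cderiv g x l -> cderiv h x m ->
  cderiv (fun t => g t + h t) x (l + m).
Proof.
intros [G1 G2] [H1 H2]. split.
- exact (is_derive_plus (fun t => Re (g t)) (fun t => Re (h t)) x _ _ G1 H1).
- exact (is_derive_plus (fun t => Im (g t)) (fun t => Im (h t)) x _ _ G2 H2).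
Qed.

Lemma cderiv_const c x : cderiv (fun _ => c) x 0.
Proof. split; exact (is_derive_const (K := R_AbsRing) (V := R_NormedModule) _ x). Qed.

Lemma cderiv_affine a d x : cderiv (fun t : R => a + d * RtoC t) x d.
Proof.
destruct a as [a1 a2], d as [d1 d2]. split; simpl; auto_derive; auto; ring.
Qed.

Lemma cderiv_mult g h x l m : cderiv g x l -> cderiv h x m ->
  cderiv (fun t => g t * h t) x (l * h x + g x * m).
Proof.
intros [G1 G2] [H1 H2].
assert (K : forall (u v : R -> R) (du dv : R), is_derive u x du -> is_derive v x dv ->
  is_derive (fun t => u t * v t)%R x (du * v x + u x * dv)%R).
{ intros u v du dv Hu Hv. exact (is_derive_mult u v x du dv Hu Hv Rmult_comm). }
split; simpl.
- assert (E := is_derive_minus _ _ x _ _ (K _ _ _ _ G1 H1) (K _ _ _ _ G2 H2)).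
  unfold minus, plus, opp in E; simpl in E.
  replace ((Re l * Re (h x) + Re (g x) * Re m + - (Im l * Im (h x) + Im (g x) * Im m)))%R
    with (Re (l * h x + g x * m)) in E by (unfold Re, Im; simpl; ring).
  exact E.
- assert (E := is_derive_plus _ _ x _ _ (K _ _ _ _ G1 H2) (K _ _ _ _ G2 H1)).
  unfold plus in E; simpl in E.
  replace ((Re l * Im (h x) + Re (g x) * Im m + (Im l * Re (h x) + Im (g x) * Re m)))%R
    with (Im (l * h x + g x * m)) in E by (unfold Re, Im; simpl; ring).
  exact E.
Qed.

Lemma cderiv_pow g x l n : cderiv g x l ->
  cderiv (fun t => g t ^ S n) x (RtoC (INR (S n)) * g x ^ n * l).
Proof.
intros Hg. induction n as [|n IH].
- simpl. replace (RtoC 1 * 1 * l) with (l * 1 + g x * 0) by ring.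
  exact (cderiv_mult g (fun _ => RtoC 1) x l 0 Hg (cderiv_const 1 x)).
- replace (RtoC (INR (S (S n))) * g x ^ S n * l)
    with (l * g x ^ S n + g x * (RtoC (INR (S n)) * g x ^ n * l)).
  + exact (cderiv_mult g (fun t => g t ^ S n) x l _ Hg IH).
  + rewrite (S_INR (S n)), RtoC_plus. rewrite (Cpow_S (g x) n). ring.
Qed.

Lemma RtoC_INR_S_neq0 n : RtoC (INR (S n)) <> 0.
Proof. intros E. apply RtoC_inj in E. now apply (not_0_INR (S n)). Qed.

(** Induction over the Horner form needs the stronger claim for z^k p(z), because
    passing to the tail of p raises the power of z in front of it. *)
Lemma peval_primitive p : exists Q : C -> C, forall a d x,
  cderiv (fun t : R => Q (a + d * RtoC t)) x (d * peval p (a + d * RtoC x)).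
Proof.
enough (K : forall p k, exists Q : C -> C, forall a d x,
  cderiv (fun t : R => Q (a + d * RtoC t)) x
    (d * ((a + d * RtoC x) ^ k * peval p (a + d * RtoC x)))).
{ destruct (K p O) as [Q HQ]. exists Q. intros a d x.
  replace (peval p (a + d * x)) with ((a + d * x) ^ 0 * peval p (a + d * x)) by (simpl; ring).
  apply HQ. }
clear p. induction p as [|c p IH]; intros k.
- exists (fun _ => 0). intros a d x. simpl.
  replace (d * ((a + d * x) ^ k * 0)) with (RtoC 0) by ring. apply cderiv_const.
- destruct (IH (S k)) as [Q HQ].
  exists (fun z => c / RtoC (INR (S k)) * z ^ S k + Q z). intros a d x.
  replace (d * ((a + d * x) ^ k * peval (c :: p) (a + d * x)))
    with ((0 * (a + d * RtoC x) ^ S k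
            + c / RtoC (INR (S k)) * (RtoC (INR (S k)) * (a + d * RtoC x) ^ k * d))
          + d * ((a + d * RtoC x) ^ S k * peval p (a + d * RtoC x))).
  + apply cderiv_plus; [|apply HQ].
    apply (cderiv_mult (fun _ => c / RtoC (INR (S k))) (fun t => (a + d * RtoC t) ^ S k)).
    * apply cderiv_const.
    * apply cderiv_pow, cderiv_affine.
  + cbn [peval]. rewrite Cpow_S. field. apply RtoC_INR_S_neq0.
Qed.

Definition segint (f : C -> C) (a d : C) : C := cint (fun u => d * f (a + d * u)).

Lemma entire_segment f a d : entire f -> entire (fun u => d * f (a + d * u)).
Proof. intros Hf. apply entire_scal, (entire_comp f); auto using entire_affine. Qed.

Lemma segint_peval p : exists Q : C -> C, forall a d,
  segint (peval p) a d = Q (a + d) - Q a.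
Proof.
destruct (peval_primitive p) as [Q HQ]. exists Q. intros a d.
assert (E := entire_real_continuous _ (entire_segment _ a d (entire_peval p))).
assert (E0 : Q (a + d) - Q a = Q (a + d * RtoC 1) - Q (a + d * RtoC 0)).
{ f_equal; [|f_equal]; f_equal; ring. }
rewrite E0.
apply injective_projections.
- change (RInt (fun x : R => Re (d * peval p (a + d * RtoC x))) 0 1
    = Re (Q (a + d * RtoC 1) - Q (a + d * RtoC 0))).
  rewrite (is_RInt_unique (V := R_CompleteNormedModule) _ 0 1 _
    (is_RInt_derive (V := R_CompleteNormedModule) (fun t => Re (Q (a + d * RtoC t))) _ 0 1
      (fun x _ => proj1 (HQ a d x)) (fun x _ => proj1 (E x)))).
  reflexivity.
- change (RInt (fun x : R => Im (d * peval p (a + d * RtoC x))) 0 1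
    = Im (Q (a + d * RtoC 1) - Q (a + d * RtoC 0))).
  rewrite (is_RInt_unique (V := R_CompleteNormedModule) _ 0 1 _
    (is_RInt_derive (V := R_CompleteNormedModule) (fun t => Im (Q (a + d * RtoC t))) _ 0 1
      (fun x _ => proj2 (HQ a d x)) (fun x _ => proj2 (E x)))).
  reflexivity.
Qed.

Lemma segint_minus f g a d : entire f -> entire g ->
  segint (fun z => f z - g z) a d = segint f a d - segint g a d.
Proof.
intros Hf Hg. unfold segint.
rewrite (cint_ext _ (fun u => d * f (a + d * u) + (- (1)) * (d * g (a + d * u))))
  by (intros x; ring).
rewrite cint_plus, (cint_scal (- (1)) (fun u => d * g (a + d * u)))
  by auto using entire_segment, entire_scal. ring.
Qed.

Lemma segint_bound f a d r eps : entire f ->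
  (Cmod a + Cmod d <= r)%R -> (forall z, (Cmod z <= r)%R -> (Cmod (f z) <= eps)%R) ->
  (Cmod (segint f a d) <= 2 * (Cmod d * eps))%R.
Proof.
intros Hf Hr H. apply cint_bound; [now apply entire_segment|].
intros x Hx. rewrite Cmod_mult. apply Rmult_le_compat_l; [apply Cmod_ge_0|].
apply H. eapply Rle_trans; [apply Cmod_triangle|].
rewrite Cmod_mult, Cmod_R, Rabs_pos_eq by lra.
generalize (Cmod_ge_0 d). nra.
Qed.

(** For a polynomial both sides are the increment of a primitive from 0 to 1 + w.
    The difference of the two sides is linear in f and small when f is uniformly
    small near the parallelogram, so it vanishes for limits of polynomials. *)
Lemma cauchy_parallelogram f w : entire f ->
  segint f 0 1 + segint f 1 w = segint f 0 w + segint f w 1.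
Proof.
intros Hf.
set (D := fun f : C -> C => segint f 0 1 + segint f 1 w - segint f 0 w - segint f w 1).
enough (H0 : D f = 0).
{ unfold D in H0. replace (segint f 0 1 + segint f 1 w)
  with ((segint f 0 1 + segint f 1 w - segint f 0 w - segint f w 1)
    + (segint f 0 w + segint f w 1)) by ring. rewrite H0. ring. }
apply Cmod_eq_0, Rle_antisym; [|apply Cmod_ge_0].
apply le_epsilon. intros eps He. rewrite Rplus_0_l.
set (B := (4 + 4 * Cmod w)%R).
assert (HB : (0 < B)%R) by (unfold B; generalize (Cmod_ge_0 w); lra).
destruct (Hf (1 + Cmod w)%R (eps / B)%R) as [p Hp]; [apply Rdiv_lt_0_compat; lra|].
assert (Hd : entire (fun z => f z - peval p z)) by auto using entire_minus, entire_peval.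
assert (Dp : D (peval p) = 0).
{ unfold D. destruct (segint_peval p) as [Q HQ]. rewrite !HQ.
  replace (0 + 1) with (RtoC 1) by ring. replace (w + 1) with (1 + w) by ring.
  replace (0 + w) with w by ring. ring. }
replace (D f) with (D (fun z => f z - peval p z)).
2:{ unfold D in *. rewrite !segint_minus by auto using entire_peval.
    transitivity (segint f 0 1 + segint f 1 w - segint f 0 w - segint f w 1
      - (segint (peval p) 0 1 + segint (peval p) 1 w - segint (peval p) 0 w - segint (peval p) w 1));
    [ring|]. rewrite Dp. ring. }
unfold D.
assert (S : forall a d, (Cmod a + Cmod d <= 1 + Cmod w)%R ->
  (Cmod (segint (fun z => f z - peval p z)%C a d) <= 2 * (Cmod d * (eps / B)))%R).
{ intros a d Had. apply (segint_bound _ a d (1 + Cmod w)%R); auto. }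
assert (Hw := Cmod_ge_0 w).
assert (A1 := S 0 1). assert (A2 := S 1 w). assert (A3 := S 0 w). assert (A4 := S w 1).
rewrite ?Cmod_0, ?Cmod_1 in *.
specialize (A1 ltac:(lra)). specialize (A2 ltac:(lra)).
specialize (A3 ltac:(lra)). specialize (A4 ltac:(lra)).
set (g := fun z => f z - peval p z) in *.
unfold Cminus.
eapply Rle_trans; [apply Cmod_triangle|].
eapply Rle_trans; [apply Rplus_le_compat_r, Cmod_triangle|].
eapply Rle_trans; [apply Rplus_le_compat_r, Rplus_le_compat_r, Cmod_triangle|].
rewrite !Cmod_opp.
replace eps with (2 * (1 * (eps / B)) + 2 * (Cmod w * (eps / B)) + 2 * (Cmod w * (eps / B))
  + 2 * (1 * (eps / B)))%R at 1 by (unfold B in *; field; lra).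
lra.
Qed.

(** The two sides of the parallelogram in the direction of w cancel by periodicity,
    so an integral over a period does not depend on the line of integration. *)
Lemma cint_shift f w : entire f -> (forall z, f (z + 1) = f z) ->
  cint (fun u => f (w + u)) = cint f.
Proof.
intros Hf Hp. assert (H := cauchy_parallelogram f w Hf). unfold segint in H.
rewrite (cint_ext (fun u => 1 * f (0 + 1 * u)) f) in H
  by (intros x; rewrite !Cmult_1_l, Cplus_0_l; reflexivity).
rewrite (cint_ext (fun u => 1 * f (w + 1 * u)) (fun u => f (w + u))) in H
  by (intros x; rewrite !Cmult_1_l; reflexivity).
rewrite (cint_ext (fun u => w * f (1 + w * u)) (fun u => w * f (0 + w * u))) in H.
2:{ intros x. rewrite <- (Hp (0 + w * x)). do 2 f_equal. ring. }
set (X := cint (fun u => w * f (0 + w * u))) in H.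
replace (cint f) with ((cint f + X) - X) by ring. rewrite H. ring.
Qed.

(** * The complex exponential *)

Lemma Cexp_plus z w : Cexp (z + w) = Cexp z * Cexp w.
Proof.
unfold Cexp, Re, Im. simpl. rewrite exp_plus, cos_plus, sin_plus.
apply injective_projections; simpl; ring.
Qed.

Lemma Cexp_0 : Cexp 0 = 1.
Proof.
unfold Cexp, Re, Im; simpl. rewrite exp_0, cos_0, sin_0.
apply injective_projections; simpl; ring.
Qed.

Lemma Cmod_Cexp z : Cmod (Cexp z) = exp (Re z).
Proof.
unfold Cmod, Cexp; simpl.
replace ((exp (Re z) * cos (Im z)) * ((exp (Re z) * cos (Im z)) * 1)
  + (exp (Re z) * sin (Im z)) * ((exp (Re z) * sin (Im z)) * 1))%R
  with (Rsqr (exp (Re z)) * (Rsqr (sin (Im z)) + Rsqr (cos (Im z))))%R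
  by (unfold Rsqr; ring).
rewrite sin2_cos2, Rmult_1_r. apply sqrt_Rsqr, Rlt_le, exp_pos.
Qed.

Lemma Cexp_neq0 z : Cexp z <> 0.
Proof. apply Cmod_gt_0. rewrite Cmod_Cexp. apply exp_pos. Qed.

Lemma Cexp_opp z : Cexp (- z) = / Cexp z.
Proof.
assert (H : Cexp z * Cexp (- z) = 1)
  by (rewrite <- Cexp_plus; replace (z + - z) with (RtoC 0) by ring; apply Cexp_0).
rewrite <- (Cmult_1_l (Cexp (- z))), <- (Cinv_l (Cexp z) (Cexp_neq0 z)).
rewrite <- Cmult_assoc, H. ring.
Qed.

Lemma Cexp_pow z n : Cexp z ^ n = Cexp (RtoC (INR n) * z).
Proof.
induction n as [|n IH].
- simpl. rewrite Cmult_0_l, Cexp_0. reflexivity.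
- rewrite Cpow_S, IH, <- Cexp_plus, S_INR, RtoC_plus. f_equal. ring.
Qed.

Lemma Cexp_PI_Ci : Cexp (PI * Ci) = - (1).
Proof.
unfold Cexp, Re, Im; simpl.
replace (PI * 0 - 0 * 1)%R with 0%R by ring. replace (PI * 1 + 0 * 0)%R with PI by ring.
rewrite exp_0, cos_PI, sin_PI. apply injective_projections; simpl; ring.
Qed.

Lemma Cexp_2PI_Ci n : Cexp (2 * PI * Ci * IZR n) = 1.
Proof.
assert (P : Cexp (2 * PI * Ci) = 1).
{ replace (2 * PI * Ci) with (PI * Ci + PI * Ci) by ring.
  rewrite Cexp_plus, Cexp_PI_Ci. ring. }
assert (N : forall k : nat, Cexp (2 * PI * Ci * IZR (Z.of_nat k)) = 1).
{ intros k. rewrite <- INR_IZR_INZ, Cmult_comm, <- Cexp_pow, P. apply Cpow_1_l. }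
destruct (Z_le_gt_dec 0 n) as [Hn | Hn].
- rewrite <- (Z2Nat.id n Hn). apply N.
- replace (2 * PI * Ci * IZR n) with (- (2 * PI * Ci * IZR (Z.of_nat (Z.to_nat (- n))))).
  + rewrite Cexp_opp, N. field.
  + rewrite Z2Nat.id by lia. rewrite opp_IZR, RtoC_opp. ring.
Qed.

Lemma Rabs_sin_le x : (Rabs (sin x) <= Rabs x)%R.
Proof.
destruct (MVT_gen sin 0 x cos) as [c [_ Hc]].
- intros t _. apply is_derive_sin.
- intros t _. apply continuity_sin.
- rewrite sin_0, !Rminus_0_r in Hc. rewrite Hc, Rabs_mult.
  generalize (COS_bound c) (Rabs_pos x). intros [A B] D.
  assert (Rabs (cos c) <= 1)%R by (apply Rabs_le; lra). nra.
Qed.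

Lemma Rabs_cos_minus_1 x : (Rabs (cos x - 1) <= x ^ 2 / 2)%R.
Proof.
replace x with (2 * (x / 2))%R at 1 by field. rewrite cos_2a_sin.
generalize (Rabs_sin_le (x / 2)). intros H.
apply Rsqr_le_abs_1 in H. unfold Rsqr in H.
rewrite Rabs_left1 by nra. nra.
Qed.

Lemma Rabs_sin_minus_id x : (Rabs x <= 1)%R -> (Rabs (sin x - x) <= x ^ 2)%R.
Proof.
intros Hx. destruct (MVT_gen (fun t => sin t - t)%R 0 x (fun t => cos t - 1)%R) as [c [Hc E]].
- intros t _. auto_derive; auto; ring.
- intros t _. apply derivable_continuous_pt. exists (cos t - 1)%R.
  apply is_derive_Reals. auto_derive; auto; ring.
- rewrite sin_0 in E. replace (sin x - x)%R with ((cos c - 1) * x)%R by lra.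
  rewrite Rabs_mult. assert (A := Rabs_cos_minus_1 c).
  assert (Hcx : (Rabs c <= Rabs x)%R).
  { revert Hc. unfold Rmin, Rmax, Rabs.
    destruct (Rle_dec 0 x), (Rcase_abs c), (Rcase_abs x); lra. }
  assert (c ^ 2 <= x ^ 2)%R.
  { rewrite <- (pow2_abs c), <- (pow2_abs x). apply pow_incr. split; auto using Rabs_pos. }
  generalize (Rabs_pos x). rewrite <- (pow2_abs x) in *. nra.
Qed.

Lemma exp_minus_1_minus_id x : (Rabs x <= / 2)%R -> (0 <= exp x - 1 - x <= 2 * x ^ 2)%R.
Proof.
intros Hx. assert (Hx2 : (- / 2 <= x <= / 2)%R) by (revert Hx; unfold Rabs; destruct (Rcase_abs x); lra).
split; [generalize (exp_ineq1_le x); lra|].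
assert (A := exp_ineq1_le (- x)). assert (B : (exp x * exp (- x) = 1)%R)
  by (rewrite <- exp_plus, Rplus_opp_r; apply exp_0).
assert (P := exp_pos x). assert (D : (exp x * (1 - x) <= 1)%R) by nra.
assert ((1 + x + 2 * x ^ 2) * (1 - x) >= 1)%R by nra. nra.
Qed.

Lemma Cexp_taylor2 h : (Cmod h <= / 2)%R -> (Cmod (Cexp h - 1 - h) <= 6 * Cmod h ^ 2)%R.
Proof.
intros Hh. destruct h as [x y].
assert (Hx := re_le_Cmod (x, y)). assert (Hy := Im_le_Cmod (x, y)). simpl in Hx, Hy.
set (r := Cmod (x, y)) in *. assert (Hr : (0 <= r)%R) by apply Cmod_ge_0.
eapply Rle_trans; [apply Cmod_le_Re_Im|]. simpl.
assert (X := exp_minus_1_minus_id x ltac:(lra)).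
assert (Cy := Rabs_cos_minus_1 y). assert (Sy := Rabs_sin_minus_id y ltac:(lra)).
assert (S0 := Rabs_sin_le y).
assert (X2 : (x ^ 2 <= r ^ 2)%R) by (rewrite <- (pow2_abs x); apply pow_incr; split; [apply Rabs_pos|lra]).
assert (Y2 : (y ^ 2 <= r ^ 2)%R) by (rewrite <- (pow2_abs y); apply pow_incr; split; [apply Rabs_pos|lra]).
assert (X1 : (- r <= x <= r)%R) by (apply Rabs_le_between; lra).
assert (E2 : (exp x <= 2)%R) by nra.
assert (E1 : (Rabs (exp x - 1) <= 2 * r)%R) by (apply Rabs_le; nra).
assert (T1 : (Rabs (exp x * cos y + - (1) + - x) <= 3 * r ^ 2)%R).
{ replace (exp x * cos y + - (1) + - x)%R with ((exp x - 1 - x) + exp x * (cos y - 1))%R by ring.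
  eapply Rle_trans; [apply Rabs_triang|]. rewrite Rabs_mult.
  rewrite (Rabs_pos_eq (exp x - 1 - x)) by lra. rewrite (Rabs_pos_eq (exp x)) by (apply Rlt_le, exp_pos).
  generalize (exp_pos x) (Rabs_pos (cos y - 1)). nra. }
assert (T2 : (Rabs (exp x * sin y + - 0 + - y) <= 3 * r ^ 2)%R).
{ replace (exp x * sin y + - 0 + - y)%R with ((exp x - 1) * sin y + (sin y - y))%R by ring.
  eapply Rle_trans; [apply Rabs_triang|]. rewrite Rabs_mult.
  assert (Rabs (exp x - 1) * Rabs (sin y) <= 2 * r * r)%R
    by (apply Rmult_le_compat; try apply Rabs_pos; lra).
  nra. }
unfold Re, Im; simpl. simpl in T1, T2. lra.
Qed.

Lemma Cmod_pow_minus_pow a b M n : (1 <= M)%R -> (Cmod a <= M)%R -> (Cmod b <= M)%R ->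
  (Cmod (a ^ n - b ^ n) <= INR n * M ^ n * Cmod (a - b))%R.
Proof.
intros HM Ha Hb. induction n as [|n IH].
- simpl. replace (RtoC 1 - RtoC 1) with (RtoC 0) by ring. rewrite Cmod_0. lra.
- rewrite !Cpow_S, S_INR.
  replace (a * a ^ n - b * b ^ n) with (a * (a ^ n - b ^ n) + (a - b) * b ^ n) by ring.
  eapply Rle_trans; [apply Cmod_triangle|]. rewrite !Cmod_mult, Cmod_pow.
  assert (Mn : (1 <= M ^ n)%R) by (apply pow_R1_Rle; lra).
  assert (Bn : (Cmod b ^ n <= M ^ n)%R) by (apply pow_incr; split; [apply Cmod_ge_0|lra]).
  assert (Cmod a * Cmod (a ^ n - b ^ n) <= M * (INR n * M ^ n * Cmod (a - b)))%R
    by (apply Rmult_le_compat; auto using Cmod_ge_0).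
  assert (Cmod (a - b) * Cmod b ^ n <= Cmod (a - b) * (M * M ^ n))%R.
  { apply Rmult_le_compat_l; [apply Cmod_ge_0|]. nra. }
  simpl. lra.
Qed.

Lemma exp_INR_mult x n : (exp x ^ n = exp (INR n * x))%R.
Proof.
induction n as [|n IH]; [simpl; now rewrite Rmult_0_l, exp_0|].
simpl pow. rewrite IH, <- exp_plus, S_INR. f_equal. ring.
Qed.

(** Since exp(z) = exp(z/N)^N, the second order bound at z/N shows that the
    polynomials (1 + z/N)^N converge locally uniformly with error O(1/N). *)
Lemma entire_Cexp : entire Cexp.
Proof.
apply entire_limit. intros r0 eps He.
set (r := (Rabs r0 + 1)%R). assert (Hr : (1 <= r)%R) by (unfold r; generalize (Rabs_pos r0); lra).
(* The summand 2 r brings z/N into the range of the Taylor bound, the other one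
   makes the accumulated error at most eps. *)
destruct (nfloor_ex (2 * r + 6 * exp r * r ^ 2 / eps)) as [n [_ Hn]].
{ assert (0 <= 6 * exp r * r ^ 2 / eps)%R; [|lra].
  apply Rdiv_le_0_compat; [|lra]. generalize (exp_pos r). nra. }
set (N := S n). rewrite <- S_INR in Hn. fold N in Hn.
assert (P : (0 <= 6 * exp r * r ^ 2 / eps)%R).
{ apply Rdiv_le_0_compat; [|lra]. generalize (exp_pos r). nra. }
assert (HN : (0 < INR N)%R) by lra.
exists (fun z => (1 + / RtoC (INR N) * z) ^ N). split.
{ apply entire_pow, entire_affine. }
intros z Hz0. assert (Hz : (Cmod z <= r)%R) by (unfold r; generalize (RRle_abs r0); lra).
assert (NC : RtoC (INR N) <> 0) by apply RtoC_INR_S_neq0.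
set (h := / RtoC (INR N) * z).
assert (Hh : (Cmod h <= r / INR N)%R).
{ unfold h. rewrite Cmod_mult, Cmod_inv, Cmod_R, Rabs_pos_eq by (auto; lra).
  unfold Rdiv. rewrite Rmult_comm. apply Rmult_le_compat_r; [|exact Hz].
  apply Rlt_le, Rinv_0_lt_compat, HN. }
assert (Hr2 : (r / INR N <= / 2)%R).
{ apply (Rmult_le_reg_r (INR N)); [lra|]. unfold Rdiv. rewrite Rmult_assoc, Rinv_l by lra. lra. }
assert (Ez : Cexp z = Cexp h ^ N).
{ rewrite Cexp_pow. f_equal. unfold h. field. exact NC. }
rewrite Ez.
assert (R1 : (Re h <= r / INR N)%R).
{ generalize (re_le_Cmod h) (RRle_abs (Re h)). lra. }
eapply Rle_trans.
{ apply (Cmod_pow_minus_pow _ _ (exp (r / INR N))).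
  - generalize (exp_ineq1_le (r / INR N)). assert (0 < r / INR N)%R by (apply Rdiv_lt_0_compat; lra). lra.
  - rewrite Cmod_Cexp. destruct R1 as [R1|R1]; [left; now apply exp_increasing | rewrite R1; lra].
  - eapply Rle_trans; [apply Cmod_triangle|]. rewrite Cmod_1.
    generalize (exp_ineq1_le (r / INR N)). fold h. lra. }
rewrite exp_INR_mult. replace (INR N * (r / INR N))%R with r by (field; lra).
fold h. replace (Cexp h - (1 + h)) with (Cexp h - 1 - h) by ring.
assert (T := Cexp_taylor2 h ltac:(lra)).
assert (Cmod h ^ 2 <= (r / INR N) ^ 2)%R by (apply pow_incr; split; [apply Cmod_ge_0|lra]).
apply Rle_trans with (INR N * exp r * (6 * (r / INR N) ^ 2))%R.
{ apply Rmult_le_compat_l; [|lra]. generalize (exp_pos r). nra. }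
replace (INR N * exp r * (6 * (r / INR N) ^ 2))%R with ((6 * exp r * r ^ 2) / INR N)%R by (field; lra).
apply (Rmult_le_reg_r (INR N)); [lra|]. unfold Rdiv. rewrite Rmult_assoc, Rinv_l, Rmult_1_r by lra.
replace (6 * exp r * r ^ 2)%R with (eps * (6 * exp r * r ^ 2 / eps))%R by (field; lra).
apply Rmult_le_compat_l; lra.
Qed.

Lemma entire_Cexp_comp f : entire f -> entire (fun z => Cexp (f z)).
Proof. intros Hf. apply (entire_comp Cexp); auto using entire_Cexp. Qed.

Lemma entire_Csin : entire Csin.
Proof.
unfold Csin. apply (entire_ext (fun z => / (2 * Ci) * (Cexp (0 + Ci * z) - Cexp (0 + (- Ci) * z)))).
- intros z. unfold Cdiv. rewrite Cmult_comm. do 3 f_equal; [|f_equal]; ring.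
- apply entire_scal, entire_minus; apply entire_Cexp_comp, entire_affine.
Qed.

(** * Uniqueness of Fourier coefficients *)

Definition sin_pi_sq (x : R) : R := (sin (PI * x) ^ 2)%R.

Lemma sin_pi_sq_bound x : (0 <= sin_pi_sq x <= 1)%R.
Proof.
unfold sin_pi_sq. generalize (SIN_bound (PI * x)). intros. nra.
Qed.

Lemma continuous_sin_pi_sq_pow m x : continuous (fun t => sin_pi_sq t ^ m)%R x.
Proof.
apply (ex_derive_continuous (V := R_NormedModule)).
unfold sin_pi_sq. auto_derive. auto.
Qed.

Definition wallis (m : nat) : R := RInt (fun x => sin_pi_sq x ^ m)%R 0 1.

Lemma ex_RInt_sin_pi_sq_pow m : ex_RInt (fun x => sin_pi_sq x ^ m)%R 0 1.
Proof.
apply (ex_RInt_continuous (V := R_CompleteNormedModule)). intros x _.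
apply continuous_sin_pi_sq_pow.
Qed.

Lemma RInt_sin_pi_sq_comb c d m n :
  RInt (fun x => c * sin_pi_sq x ^ m + d * sin_pi_sq x ^ n)%R 0 1 = (c * wallis m + d * wallis n)%R.
Proof.
apply (is_RInt_unique (V := R_CompleteNormedModule)).
apply (is_RInt_plus (V := R_NormedModule));
  apply (is_RInt_scal (V := R_NormedModule)), (RInt_correct (V := R_CompleteNormedModule)),
    ex_RInt_sin_pi_sq_pow.
Qed.

(** Integrate the derivative of cos(pi x) sin(pi x)^(2m+1), whose primitive
    vanishes at 0 and 1. *)
Lemma wallis_rec m : (INR (2 * m + 2) * wallis (S m) = INR (2 * m + 1) * wallis m)%R.
Proof.
assert (D : forall x, is_derive (fun x => cos (PI * x) * sin (PI * x) ^ (2 * m + 1))%R x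
   ((PI * INR (2 * m + 1)) * sin_pi_sq x ^ m + (- (PI * INR (2 * m + 2))) * sin_pi_sq x ^ S m)%R).
{ intros x. auto_derive; auto. unfold sin_pi_sq.
  replace (2 * m + 2)%nat with (S (2 * m + 1)) by lia.
  replace (pred (2 * m + 1)) with (2 * m)%nat by lia.
  replace (m + (m + 0) + 1)%nat with (S (2 * m)) by lia.
  replace (2 * m + 1)%nat with (S (2 * m)) by lia. rewrite Nat.pred_succ.
  rewrite !S_INR, <- !pow_mult. replace (2 * S m)%nat with (S (S (2 * m))) by lia.
  rewrite <- !tech_pow_Rmult.
  generalize (sin2_cos2 (PI * x)). unfold Rsqr. intros T.
  replace (cos (PI * x) * (PI * 1 * cos (PI * x) * ((INR (2 * m) + 1) * sin (PI * x) ^ (2 * m))))%R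
    with ((cos (PI * x) * cos (PI * x)) * (PI * ((INR (2 * m) + 1) * sin (PI * x) ^ (2 * m))))%R by ring.
  replace (cos (PI * x) * cos (PI * x))%R with (1 - sin (PI * x) * sin (PI * x))%R by lra. ring. }
assert (I := is_RInt_derive (V := R_CompleteNormedModule) _ _ 0 1 (fun x _ => D x)).
assert (C : forall x, continuous (fun x => (PI * INR (2 * m + 1)) * sin_pi_sq x ^ m
   + (- (PI * INR (2 * m + 2))) * sin_pi_sq x ^ S m)%R x).
{ intros x. apply (ex_derive_continuous (V := R_NormedModule)). unfold sin_pi_sq. auto_derive. auto. }
specialize (I (fun x _ => C x)). apply (is_RInt_unique (V := R_CompleteNormedModule)) in I.
rewrite RInt_sin_pi_sq_comb in I. unfold minus, plus, opp in I; simpl in I.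
rewrite Rmult_0_r, Rmult_1_r, sin_PI, sin_0 in I.
rewrite pow_i in I by lia. assert (PI > 0)%R by apply PI_RGT_0.
replace (m + (m + 0))%nat with (2 * m)%nat in I by lia.
assert (Z : (INR (2 * m + 1) * wallis m - INR (2 * m + 2) * wallis (S m) = 0)%R).
{ apply (Rmult_eq_reg_l PI); lra. }
lra.
Qed.

Lemma wallis_pos m : (0 < wallis m)%R.
Proof.
induction m as [|m IH].
- unfold wallis. simpl.
  rewrite (RInt_const (V := R_CompleteNormedModule)). unfold scal; simpl. unfold mult; simpl. lra.
- apply (Rmult_lt_reg_l (INR (2 * m + 2))); [apply lt_0_INR; lia|].
  rewrite Rmult_0_r, wallis_rec. apply Rmult_lt_0_compat; [apply lt_0_INR; lia | exact IH].
Qed.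

Lemma one_minus_sin_pi_sq x : (1 - sin_pi_sq x = cos (PI * x) ^ 2)%R.
Proof. unfold sin_pi_sq. generalize (sin2_cos2 (PI * x)). unfold Rsqr. lra. Qed.

Lemma sin_pi_sq_away d x : (0 < d < / 2)%R -> (0 <= x <= 1)%R -> (d <= Rabs (x - / 2))%R ->
  (sin (PI * d) ^ 2 <= 1 - sin_pi_sq x)%R.
Proof.
intros Hd Hx Hxd. rewrite one_minus_sin_pi_sq.
assert (P := PI_RGT_0).
assert (S0 : (0 < sin (PI * d))%R) by (apply sin_gt_0; nra).
destruct (Rle_dec x (/ 2)) as [L|L].
- rewrite Rabs_left1 in Hxd by lra.
  assert (sin (PI * d) <= cos (PI * x))%R; [|nra].
  rewrite <- cos_shift. apply cos_decr_1; nra.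
- rewrite Rabs_pos_eq in Hxd by lra.
  assert (sin (PI * d) <= - cos (PI * x))%R; [|nra].
  rewrite <- Rtrigo_facts.cos_pi_minus, <- cos_shift.
  apply cos_decr_1; nra.
Qed.

(** Near 1/2 the function h exceeds h(1/2)/2; away from 1/2 the factor 1 - sin^2
    is bounded below, so that h >= h(1/2)/2 - K (1 - sin^2) on the whole interval.
    Integrated against sin^(2m) this contradicts Wallis' recurrence for large m. *)
Lemma sin_moments_nonpos (h : R -> R) (M : R) :
  (forall x, continuous h x) -> (forall x, (0 <= x <= 1)%R -> (Rabs (h x) <= M)%R) ->
  (forall m, RInt (fun x => h x * sin_pi_sq x ^ m)%R 0 1 = 0%R) -> (h (/ 2) <= 0)%R.
Proof.
intros Hc HM H0. apply Rnot_lt_le. intros Ha. set (a := h (/ 2)%R) in *.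
assert (exists d, (0 < d < / 2)%R /\ forall x, (Rabs (x - / 2) < d)%R -> (a / 2 <= h x)%R)
  as [d [Hd Hnear]].
{ destruct (Hc (/ 2)%R (ball a (a / 2)%R)) as [e He].
  { exists (mkposreal (a / 2) ltac:(lra)). intros y Hy. exact Hy. }
  exists (Rmin (/ 4) e). split.
  - split; [apply Rmin_glb_lt; [lra | apply cond_pos]|].
    eapply Rle_lt_trans; [apply Rmin_l | lra].
  - intros x Hx. assert (B : (Rabs (h x - a) < a / 2)%R).
    { apply He. apply (Rlt_le_trans _ _ _ Hx (Rmin_r _ _)). }
    apply Rabs_lt_between in B. lra. }
assert (Sd : (0 < sin (PI * d) ^ 2)%R).
{ apply pow_lt, sin_gt_0; generalize PI_RGT_0; nra. }
set (K := ((M + a) / sin (PI * d) ^ 2)%R).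
assert (M0 : (a <= M)%R).
{ generalize (HM (/ 2)%R ltac:(lra)) (RRle_abs (h (/ 2)%R)). fold a. lra. }
assert (HK : (0 < K)%R) by (apply Rdiv_lt_0_compat; lra).
assert (Hlow : forall x, (0 <= x <= 1)%R -> (a / 2 - K * (1 - sin_pi_sq x) <= h x)%R).
{ intros x Hx. generalize (sin_pi_sq_bound x). intros SB.
  destruct (Rlt_le_dec (Rabs (x - / 2)) d) as [L|L].
  - specialize (Hnear x L). nra.
  - assert (A := sin_pi_sq_away d x Hd Hx L).
    assert (B : (K * sin (PI * d) ^ 2 <= K * (1 - sin_pi_sq x))%R) by (apply Rmult_le_compat_l; lra).
    replace (K * sin (PI * d) ^ 2)%R with (M + a)%R in B by (unfold K, Rdiv; rewrite Rmult_assoc, Rinv_l; lra).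
    generalize (HM x Hx). intros D. apply Rabs_le_between in D. lra. }
(* By the recurrence K (wallis m - wallis (m+1)) = K / (2m+2) * wallis m, which is
   below a/2 * wallis m once m + 1 > K / a. *)
destruct (nfloor_ex (K / a)) as [m [_ Hm]]; [apply Rlt_le, Rdiv_lt_0_compat; lra|].
assert (EI : forall n, ex_RInt (fun x => h x * sin_pi_sq x ^ n)%R 0 1).
{ intros n. apply (ex_RInt_continuous (V := R_CompleteNormedModule)). intros x _.
  apply (continuous_mult (K := R_AbsRing) h); [apply Hc | apply continuous_sin_pi_sq_pow]. }
assert (LE : (RInt (fun x => (a / 2 - K) * sin_pi_sq x ^ m + K * sin_pi_sq x ^ S m) 0 1
  <= RInt (fun x => h x * sin_pi_sq x ^ m) 0 1)%R).
{ apply RInt_le; [lra | | apply EI |].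
  - apply (ex_RInt_plus (V := R_NormedModule));
      apply (ex_RInt_scal (V := R_NormedModule)), ex_RInt_sin_pi_sq_pow.
  - intros x Hx. rewrite <- tech_pow_Rmult.
    replace ((a / 2 - K) * sin_pi_sq x ^ m + K * (sin_pi_sq x * sin_pi_sq x ^ m))%R
      with ((a / 2 - K * (1 - sin_pi_sq x)) * sin_pi_sq x ^ m)%R by ring.
    apply Rmult_le_compat_r; [apply pow_le; apply sin_pi_sq_bound|].
    apply Hlow. lra. }
rewrite RInt_sin_pi_sq_comb, H0 in LE. assert (W := wallis_pos m). assert (Rc := wallis_rec m).
assert (Hm' : (K < a * (INR m + 1))%R).
{ apply (Rmult_lt_compat_l a) in Hm; [|lra]. replace (a * (K / a))%R with K in Hm by (field; lra). exact Hm. }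
rewrite !plus_INR, mult_INR in Rc. simpl in Rc.
assert (Wd : ((2 * (INR m + 1)) * (wallis m - wallis (S m)) = wallis m)%R) by lra.
assert (LE2 : (a / 2 * wallis m <= K * (wallis m - wallis (S m)))%R) by lra.
assert (Dp : (0 < wallis m - wallis (S m))%R) by (generalize (pos_INR m); nra).
set (dw := (wallis m - wallis (S m))%R) in *.
rewrite <- Wd in LE2. replace (a / 2 * (2 * (INR m + 1) * dw))%R with (a * (INR m + 1) * dw)%R in LE2 by field.
apply Rmult_le_reg_r in LE2; lra.
Qed.

Lemma sin_moments_zero (h : R -> R) (M : R) :
  (forall x, continuous h x) -> (forall x, (0 <= x <= 1)%R -> (Rabs (h x) <= M)%R) ->
  (forall m, RInt (fun x => h x * sin_pi_sq x ^ m)%R 0 1 = 0%R) -> h (/ 2)%R = 0%R.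
Proof.
intros Hc HM H0. apply Rle_antisym; [now apply (sin_moments_nonpos h M)|].
enough (- h (/ 2) <= 0)%R by lra.
apply (sin_moments_nonpos (fun x => - h x)%R M).
- intros x. apply (continuous_opp h x), Hc.
- intros x Hx. rewrite Rabs_Ropp. auto.
- intros m. rewrite (RInt_ext (V := R_CompleteNormedModule) _ (fun x => opp (h x * sin_pi_sq x ^ m)%R)).
  + rewrite (RInt_opp (V := R_CompleteNormedModule)), H0; [unfold opp; simpl; ring|].
    apply (ex_RInt_continuous (V := R_CompleteNormedModule)). intros x _.
    apply (continuous_mult (K := R_AbsRing) h); [apply Hc | apply continuous_sin_pi_sq_pow].
  + intros x _. unfold opp; simpl. ring.
Qed.

Definition echar (n : Z) (z : C) : C := Cexp (2 * PI * Ci * IZR n * z).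

Lemma echar_plus n z w : echar n (z + w) = echar n z * echar n w.
Proof. unfold echar. rewrite <- Cexp_plus. f_equal. ring. Qed.

Lemma echar_add n m z : echar (n + m) z = echar n z * echar m z.
Proof. unfold echar. rewrite <- Cexp_plus, plus_IZR, RtoC_plus. f_equal. ring. Qed.

Lemma echar_0 z : echar 0 z = 1.
Proof. unfold echar. rewrite <- Cexp_0. f_equal. ring. Qed.

Lemma echar_periodic n z : echar n (z + 1) = echar n z.
Proof.
rewrite echar_plus. unfold echar at 2. rewrite Cmult_1_r, Cexp_2PI_Ci. ring.
Qed.

Lemma entire_echar n : entire (echar n).
Proof.
apply (entire_ext (fun z => Cexp (0 + 2 * PI * Ci * IZR n * z))).
- intros z. unfold echar. f_equal. ring.
- apply entire_Cexp_comp, entire_affine.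
Qed.

(** The entire function sin(pi z)^2, written with characters so that multiplication
    by it turns Fourier integrals into combinations of Fourier integrals. *)
Definition Csin_pi_sq (z : C) : C := (2 - echar 1 z - echar (-1) z) / 4.

Lemma Csin_pi_sq_real (x : R) : Csin_pi_sq x = RtoC (sin_pi_sq x).
Proof.
unfold Csin_pi_sq, echar, sin_pi_sq, Cexp, Re, Im.
assert (F : forall k : R, (2 * PI * Ci * k * x)%C = (0, 2 * (PI * x) * k)%R).
{ intros k. apply injective_projections; simpl; ring. }
rewrite !F. cbn [fst snd].
replace (2 * (PI * x) * -1)%R with (- (2 * (PI * x)))%R by ring.
rewrite Rmult_1_r, cos_neg, sin_neg, exp_0, cos_2a_sin.
unfold Cdiv. rewrite <- RtoC_inv by lra.
apply injective_projections; simpl; field.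
Qed.

Lemma entire_Csin_pi_sq : entire Csin_pi_sq.
Proof.
apply (entire_ext (fun z => / 4 * (2 - echar 1 z - echar (-1) z))).
- intros z. unfold Csin_pi_sq. field.
- apply entire_scal. apply entire_minus; [apply entire_minus|]; auto using entire_const, entire_echar.
Qed.

Lemma Csin_pi_sq_moments g : entire g ->
  (forall n, cint (fun u => g u * echar n u) = 0) ->
  forall m n, cint (fun u => g u * Csin_pi_sq u ^ m * echar n u) = 0.
Proof.
intros Hg H m. induction m as [|m IH]; intros n.
- rewrite <- (H n). apply cint_ext. intros x. simpl. ring.
- assert (E : forall k, entire (fun u => g u * Csin_pi_sq u ^ m * echar k u)).
  { intros k. apply entire_mult; [apply entire_mult|]; auto using entire_pow, entire_Csin_pi_sq, entire_echar. }
  rewrite (cint_ext _ (fun u => / 2 * (g u * Csin_pi_sq u ^ m * echar n u)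
    + (- / 4 * (g u * Csin_pi_sq u ^ m * echar (n + 1) u)
       + - / 4 * (g u * Csin_pi_sq u ^ m * echar (n + -1) u)))).
  2:{ intros x. rewrite !echar_add, Cpow_S. unfold Csin_pi_sq at 1. field. }
  rewrite !cint_plus, !cint_scal by auto using entire_plus, entire_scal.
  rewrite !IH. ring.
Qed.

Lemma fourier_midpoint g : entire g ->
  (forall n, cint (fun u => g u * echar n u) = 0) -> g (/ 2) = 0.
Proof.
intros Hg H.
destruct (entire_bounded g 1 Hg) as [M [_ HM]].
assert (B : forall x : R, (0 <= x <= 1)%R -> (Cmod (g x) <= M)%R).
{ intros x Hx. apply HM. rewrite Cmod_R, Rabs_pos_eq; lra. }
assert (Z : forall m, cint (fun u => g u * Csin_pi_sq u ^ m) = 0).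
{ intros m. rewrite <- (Csin_pi_sq_moments g Hg H m 0). apply cint_ext. intros x.
  rewrite echar_0. ring. }
assert (EM : forall m (x : R), g x * Csin_pi_sq x ^ m = (Re (g x) * sin_pi_sq x ^ m, Im (g x) * sin_pi_sq x ^ m)%R).
{ intros m x. rewrite Csin_pi_sq_real, <- RtoC_pow. apply injective_projections; unfold Re, Im; simpl; ring. }
rewrite <- RtoC_inv by lra.
apply injective_projections.
- apply (sin_moments_zero (fun x : R => Re (g x)) M).
  + intros x. apply (entire_real_continuous g Hg).
  + intros x Hx. eapply Rle_trans; [apply re_le_Cmod | auto].
  + intros m. specialize (Z m). apply (f_equal fst) in Z. cbn [cint fst snd] in Z.
    etransitivity; [|exact Z].
    apply (RInt_ext (V := R_CompleteNormedModule)). intros x _.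
    change ((Re (g x) * sin_pi_sq x ^ m)%R = Re (g x * Csin_pi_sq x ^ m))%C. rewrite EM. reflexivity.
- apply (sin_moments_zero (fun x : R => Im (g x)) M).
  + intros x. apply (entire_real_continuous g Hg).
  + intros x Hx. eapply Rle_trans; [apply Im_le_Cmod | auto].
  + intros m. specialize (Z m). apply (f_equal snd) in Z. cbn [cint fst snd] in Z.
    etransitivity; [|exact Z].
    apply (RInt_ext (V := R_CompleteNormedModule)). intros x _.
    change ((Im (g x) * sin_pi_sq x ^ m)%R = Im (g x * Csin_pi_sq x ^ m))%C. rewrite EM. reflexivity.
Qed.

(** Translation by any complex w multiplies the Fourier integrals by characters, so
    they vanish for every translate, and the value at the midpoint 1/2, where
    sin(pi x)^(2m) concentrates, gives all values of f in the plane. *)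
Theorem fourier_unique f : entire f -> (forall z, f (z + 1) = f z) ->
  (forall n, cint (fun u => f u * echar n u) = 0) -> forall z, f z = 0.
Proof.
intros Hf Hp H z.
set (w := z - / 2).
assert (G : entire (fun u => f (w + u))).
{ apply (entire_ext (fun u => f (w + 1 * u))).
  - intros u. f_equal. ring.
  - apply (entire_comp f); auto using entire_affine. }
replace z with (w + / 2) by (unfold w; ring).
apply (fourier_midpoint (fun u => f (w + u)) G). intros n.
assert (N := Cexp_neq0 (2 * PI * Ci * IZR n * w)). fold (echar n w) in N.
assert (S : cint (fun u => f (w + u) * echar n (w + u)) = 0).
{ rewrite <- (H n). apply (cint_shift (fun u => f u * echar n u)).
  - apply entire_mult; auto using entire_echar.
  - intros u. rewrite Hp, echar_periodic. reflexivity. }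
rewrite (cint_ext _ (fun u => echar n w * (f (w + u) * echar n u))) in S
  by (intros x; rewrite echar_plus; ring).
rewrite cint_scal in S by (apply entire_mult; auto using entire_echar).
rewrite <- (Cmult_1_l (cint _)), <- (Cinv_l _ N), <- Cmult_assoc, S. ring.
Qed.

(** * Theta functions of a given order *)

(** Antiperiodicity in pi instead of periodicity is the normalisation of theta_1. *)
Record theta_fun (k : nat) (omega mu : C) (F : C -> C) : Prop := {
  tf_entire : entire F;
  tf_pi : forall z, F (z + PI) = - F z;
  tf_omega : forall z,
    F (z + PI * omega) = mu * Cexp (- (2 * INR k * Ci * z)) * F z }.

Lemma theta_fun_comb k omega (mu : C) F G a b :
  theta_fun k omega mu F -> theta_fun k omega mu G ->
  theta_fun k omega mu (fun z => a * F z + b * G z).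
Proof.
intros [F1 F2 F3] [G1 G2 G3]. split.
- auto using entire_plus, entire_scal.
- intros z. rewrite F2, G2. ring.
- intros z. rewrite F3, G3. ring.
Qed.

(** The factor exp(-i z) turns the antiperiod pi into a period, and the change of
    variable z = pi u makes that period 1. *)
Definition untwist (F : C -> C) (u : C) : C := F (PI * u) * Cexp (- (PI * Ci * u)).

Definition fcoef (F : C -> C) (n : Z) : C :=
  cint (fun u => untwist F u * echar (- n) u).

Lemma entire_untwist F : entire F -> entire (untwist F).
Proof.
intros H. apply entire_mult.
- apply (entire_comp F); auto using entire_scal, entire_id.
- apply entire_Cexp_comp, (entire_ext (fun u => 0 + (- (PI * Ci)) * u)).
  + intros u. ring.
  + apply entire_affine.
Qed.

Lemma entire_fcoef F n : entire F -> entire (fun u => untwist F u * echar (- n) u).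
Proof. auto using entire_mult, entire_untwist, entire_echar. Qed.

Lemma untwist_periodic k omega (mu : C) F : theta_fun k omega mu F ->
  forall u, untwist F (u + 1) = untwist F u.
Proof.
intros H u. unfold untwist.
replace (PI * (u + 1)) with (PI * u + PI) by ring. rewrite (tf_pi _ _ _ _ H).
replace (- (PI * Ci * (u + 1))) with (- (PI * Ci * u) + - (PI * Ci)) by ring.
rewrite Cexp_plus, (Cexp_opp (PI * Ci)), Cexp_PI_Ci. field.
Qed.

Lemma untwist_omega k omega (mu : C) F : theta_fun k omega mu F ->
  forall u, untwist F (omega + u)
    = mu * Cexp (- (PI * Ci * omega)) * echar (- Z.of_nat k) u * untwist F u.
Proof.
intros H u. unfold untwist.
replace (PI * (omega + u)) with (PI * u + PI * omega) by ring.
rewrite (tf_omega _ _ _ _ H).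
replace (- (PI * Ci * (omega + u))) with (- (PI * Ci * omega) + - (PI * Ci * u)) by ring.
rewrite Cexp_plus. unfold echar. rewrite opp_IZR, <- INR_IZR_INZ, RtoC_opp.
replace (- (2 * INR k * Ci * (PI * u))) with (2 * PI * Ci * - INR k * u) by ring. ring.
Qed.

Lemma fcoef_comb F G a b n : entire F -> entire G ->
  fcoef (fun z => a * F z + b * G z) n = a * fcoef F n + b * fcoef G n.
Proof.
intros HF HG. unfold fcoef.
rewrite (cint_ext _ (fun u => a * (untwist F u * echar (- n) u) + b * (untwist G u * echar (- n) u))).
2:{ intros x. unfold untwist. ring. }
rewrite cint_plus, !cint_scal by auto using entire_scal, entire_fcoef. reflexivity.
Qed.

(** Moving the line of integration by omega turns the n-th Fourier integral into
    a nonzero multiple of the (n+k)-th one. *)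
Lemma fcoef_shift k omega (mu : C) F n : theta_fun k omega mu F ->
  fcoef F n = mu * Cexp (- (PI * Ci * omega)) * echar (- n) omega * fcoef F (n + Z.of_nat k).
Proof.
intros H. assert (HF := tf_entire _ _ _ _ H). unfold fcoef at 1.
rewrite <- (cint_shift (fun u => untwist F u * echar (- n) u) omega).
- unfold fcoef. rewrite <- cint_scal by auto using entire_fcoef.
  apply cint_ext. intros x. rewrite (untwist_omega _ _ _ _ H), echar_plus.
  replace (- (n + Z.of_nat k))%Z with (- n + - Z.of_nat k)%Z by lia. rewrite echar_add. ring.
- now apply entire_fcoef.
- intros u. rewrite (untwist_periodic _ _ _ _ H), echar_periodic. reflexivity.
Qed.

Lemma fcoef_shift_zero k omega (mu : C) F n : mu <> 0 -> theta_fun k omega mu F ->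
  fcoef F n = 0 <-> fcoef F (n + Z.of_nat k) = 0.
Proof.
intros Hmu H. rewrite (fcoef_shift k omega mu F n H). split; intros E.
- set (c := mu * Cexp (- (PI * Ci * omega)) * echar (- n) omega) in *.
  assert (Hc : c <> 0) by (apply Cmult_neq_0; [apply Cmult_neq_0; [exact Hmu|]|]; apply Cexp_neq0).
  rewrite <- (Cmult_1_l (fcoef F _)), <- (Cinv_l c Hc), <- Cmult_assoc, E. ring.
- rewrite E. ring.
Qed.

(** The coefficients of index 0, ..., k-1 determine all others by steps of k in
    both directions, so the space has dimension at most k. *)
Theorem theta_fun_zero k omega (mu : C) F : mu <> 0 -> theta_fun k omega mu F ->
  (forall j, (0 <= j < Z.of_nat k)%Z -> fcoef F j = 0) -> (0 < k)%nat ->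
  forall z, F z = 0.
Proof.
intros Hmu H H0 Hk.
assert (A : forall r q, (0 <= r < Z.of_nat k)%Z -> fcoef F (r + Z.of_nat k * q) = 0).
{ intros r q Hr. revert q. apply Z.peano_ind.
  - rewrite Z.mul_0_r, Z.add_0_r. auto.
  - intros q E. apply (proj1 (fcoef_shift_zero k omega mu F _ Hmu H)) in E.
    rewrite <- E. f_equal. lia.
  - intros q E. apply (proj2 (fcoef_shift_zero k omega mu F _ Hmu H)).
    rewrite <- E. f_equal. lia. }
assert (S0 : forall u, untwist F u = 0).
{ apply fourier_unique.
  - apply entire_untwist, (tf_entire _ _ _ _ H).
  - apply (untwist_periodic _ _ _ _ H).
  - intros n. rewrite <- (A ((- n) mod Z.of_nat k)%Z ((- n) / Z.of_nat k)%Z).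
    + rewrite Z.add_comm, <- Z.div_mod by lia. unfold fcoef. rewrite Z.opp_involutive. reflexivity.
    + apply Z.mod_pos_bound. lia. }
assert (HPI : RtoC PI <> 0) by (intros E; apply RtoC_inj in E; generalize PI_RGT_0; lra).
intros z. specialize (S0 (z / PI)). unfold untwist in S0.
replace (PI * (z / PI)) with z in S0 by (field; exact HPI).
set (c := Cexp (- (PI * Ci * (z / PI)))) in S0.
assert (Hc : c <> 0) by apply Cexp_neq0.
rewrite <- (Cmult_1_r (F z)), <- (Cinv_r c Hc), Cmult_assoc, S0. ring.
Qed.

(** Theta functions of order 1 form a line: some nontrivial combination of F and
    G has zero 0-th Fourier coefficient. *)
Lemma theta_fun_1_proportional omega (mu : C) F G z0 : mu <> 0 ->
  theta_fun 1 omega mu F -> theta_fun 1 omega mu G -> G z0 <> 0 ->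
  exists c : C, forall z, F z = c * G z.
Proof.
intros Hmu HF HG Hz0.
assert (HFe := tf_entire _ _ _ _ HF). assert (HGe := tf_entire _ _ _ _ HG).
assert (HG0 : fcoef G 0 <> 0).
{ intros E. apply Hz0. apply (theta_fun_zero 1 omega mu G Hmu HG); [|lia].
  intros j Hj. replace j with 0%Z by lia. exact E. }
exists (fcoef F 0 / fcoef G 0). intros z.
assert (D : 1 * F z + - (fcoef F 0 / fcoef G 0) * G z = 0).
{ apply (theta_fun_zero 1 omega mu (fun z => 1 * F z + - (fcoef F 0 / fcoef G 0) * G z) Hmu).
  - now apply theta_fun_comb.
  - intros j Hj. replace j with 0%Z by lia. rewrite fcoef_comb by assumption. field. exact HG0.
  - lia. }
replace (F z) with ((1 * F z + - (fcoef F 0 / fcoef G 0) * G z) + fcoef F 0 / fcoef G 0 * G z)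
  by ring.
rewrite D. ring.
Qed.

Lemma cint_reflect f : entire f -> cint (fun u => f (1 - u)) = cint f.
Proof.
intros Hf. destruct (entire_ex_RInt f 1 0 Hf) as [H1 H2].
assert (K : forall g : R -> R, ex_RInt g 1 0 -> RInt (fun x => g (1 - x)%R) 0 1 = RInt g 0 1).
{ intros g Hg.
  assert (E : ex_RInt g (-1 * 0 + 1) (-1 * 1 + 1)).
  { replace (-1 * 0 + 1)%R with 1%R by ring. replace (-1 * 1 + 1)%R with 0%R by ring. exact Hg. }
  assert (L := RInt_comp_lin (V := R_CompleteNormedModule) g (-1) 1 0 1 E).
  replace (-1 * 0 + 1)%R with 1%R in L by ring. replace (-1 * 1 + 1)%R with 0%R in L by ring.
  rewrite <- (opp_RInt_swap (V := R_CompleteNormedModule) g) by exact Hg.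
  rewrite <- L.
  rewrite <- (RInt_opp (V := R_CompleteNormedModule)).
  - apply RInt_ext. intros x _. unfold opp, scal; simpl. unfold mult; simpl.
    replace (-1 * x + 1)%R with (1 - x)%R by ring. ring.
  - apply (ex_RInt_comp_lin (V := R_NormedModule) g (-1) 1 0 1 E). }
unfold cint. f_equal.
- rewrite <- (K (fun x => Re (f (RtoC x)))) by exact H1. apply RInt_ext. intros x _.
  rewrite RtoC_minus. reflexivity.
- rewrite <- (K (fun x => Im (f (RtoC x)))) by exact H2. apply RInt_ext. intros x _.
  rewrite RtoC_minus. reflexivity.
Qed.

Lemma fcoef_odd k omega (mu : C) F n : theta_fun k omega mu F -> (forall z, F (- z) = - F z) ->
  fcoef F (- n - 1) = - fcoef F n.
Proof.
intros H Hodd. assert (HF := tf_entire _ _ _ _ H). unfold fcoef.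
rewrite <- (cint_reflect _ (entire_fcoef F (- n - 1) HF)).
replace (- cint (fun u => untwist F u * echar (- n) u))
  with ((- (1)) * cint (fun u => untwist F u * echar (- n) u)) by ring.
rewrite <- cint_scal by auto using entire_fcoef.
apply cint_ext. intros x.
replace (1 - x) with (- x + 1) by ring.
rewrite (untwist_periodic _ _ _ _ H), echar_periodic. unfold untwist, echar.
replace (PI * - x) with (- (PI * x)) by ring. rewrite Hodd.
replace (- (- n - 1))%Z with (n + 1)%Z by lia. rewrite plus_IZR, opp_IZR, RtoC_plus, RtoC_opp.
transitivity (- (1) * (F (PI * x) * (Cexp (- (PI * Ci * - x)) * Cexp (2 * PI * Ci * (IZR n + IZR 1) * - x)))).
{ ring. }
rewrite <- (Cmult_assoc (F (PI * x))), <- !Cexp_plus.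
do 3 f_equal. ring.
Qed.

(** The cross product of the two rows is a relation between the columns; if it is
    zero, the first column or one of the rows gives a relation. *)
Lemma dependent_in_plane (x1 x2 x3 y1 y2 y3 : C) : exists l1 l2 l3 : C,
  (l1 <> 0 \/ l2 <> 0 \/ l3 <> 0) /\
  l1 * x1 + l2 * x2 + l3 * x3 = 0 /\ l1 * y1 + l2 * y2 + l3 * y3 = 0.
Proof.
assert (D : forall c : C, c = 0 \/ c <> 0) by (intros c; destruct (Ceq_dec c 0); auto).
assert (N : RtoC 1 <> 0) by (intros E; apply RtoC_inj in E; lra).
destruct (D (x2 * y3 - x3 * y2)) as [A|A];
  [destruct (D (x3 * y1 - x1 * y3)) as [B|B];
    [destruct (D (x1 * y2 - x2 * y1)) as [E|E]|]|].
2-4: exists (x2 * y3 - x3 * y2), (x3 * y1 - x1 * y3), (x1 * y2 - x2 * y1);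
  split; [tauto | split; ring].
destruct (D x1) as [X1|X1]; [destruct (D y1) as [Y1|Y1]|].
- exists 1, 0, 0. subst. split; [tauto | split; ring].
- exists (- y2), y1, 0. split; [tauto | split; [|ring]].
  replace (- y2 * x1 + y1 * x2 + 0 * x3) with (- (x1 * y2 - x2 * y1)) by ring.
  rewrite E. ring.
- exists (- x2), x1, 0. split; [tauto | split; [ring|]].
  replace (- x2 * y1 + x1 * y2 + 0 * y3) with (x1 * y2 - x2 * y1) by ring. exact E.
Qed.

(** The odd theta functions of order 3 form a plane: oddness ties the coefficient
    of index 2 to the one of index 0. *)
Lemma odd_theta_fun_3_dependent omega (mu : C) F1 F2 F3 : mu <> 0 ->
  theta_fun 3 omega mu F1 -> theta_fun 3 omega mu F2 -> theta_fun 3 omega mu F3 ->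
  (forall z, F1 (- z) = - F1 z) -> (forall z, F2 (- z) = - F2 z) -> (forall z, F3 (- z) = - F3 z) ->
  exists l1 l2 l3 : C, (l1 <> 0 \/ l2 <> 0 \/ l3 <> 0) /\
    forall z, l1 * F1 z + l2 * F2 z + l3 * F3 z = 0.
Proof.
intros Hmu H1 H2 H3 O1 O2 O3.
destruct (dependent_in_plane (fcoef F1 0) (fcoef F2 0) (fcoef F3 0)
  (fcoef F1 1) (fcoef F2 1) (fcoef F3 1)) as [l1 [l2 [l3 [Hl [E0 E1]]]]].
exists l1, l2, l3. split; [exact Hl|].
set (G := fun z => 1 * (l1 * F1 z + l2 * F2 z) + l3 * F3 z).
assert (HG : theta_fun 3 omega mu G).
{ apply (theta_fun_comb 3 omega mu (fun z => l1 * F1 z + l2 * F2 z) F3 1 l3); auto.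
  now apply theta_fun_comb. }
assert (OG : forall z, G (- z) = - G z).
{ intros z. unfold G. rewrite O1, O2, O3. ring. }
assert (C : forall n, fcoef G n = l1 * fcoef F1 n + l2 * fcoef F2 n + l3 * fcoef F3 n).
{ intros n. unfold G. rewrite (fcoef_comb (fun z => l1 * F1 z + l2 * F2 z) F3),
    (fcoef_comb F1 F2); try (eapply tf_entire; eassumption); [ring|].
  eapply tf_entire, theta_fun_comb; eassumption. }
assert (Z : forall z, G z = 0).
{ apply (theta_fun_zero 3 omega mu G Hmu HG); [|lia]. intros j Hj.
  assert (J : (j = 0 \/ j = 1 \/ j = 2)%Z) by lia.
  destruct J as [-> | [-> | ->]].
  - rewrite C. exact E0.
  - rewrite C. exact E1.
  - change 2%Z with (- 0 - 1 + Z.of_nat 3)%Z.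
    apply (proj1 (fcoef_shift_zero 3 omega mu G _ Hmu HG)).
    rewrite (fcoef_odd 3 omega mu G 0 HG OG), C, E0. ring. }
intros z. rewrite <- (Z z). unfold G. ring.
Qed.

(** * Limits with a geometric rate *)

Lemma pow_small K r eps : (0 <= r < 1)%R -> (0 < eps)%R -> exists n : nat, (K * r ^ n < eps)%R.
Proof.
intros Hr He. destruct (Rle_dec K 0) as [HK|HK].
- exists O. simpl. lra.
- destruct (pow_lt_1_zero r ltac:(rewrite Rabs_pos_eq; lra) (eps / K)%R) as [n Hn].
  { apply Rdiv_lt_0_compat; lra. }
  exists n. specialize (Hn n (le_n n)). rewrite Rabs_pos_eq in Hn by (apply pow_le; lra).
  apply (Rmult_lt_compat_l K) in Hn; [|lra]. replace (K * (eps / K))%R with eps in Hn by (field; lra).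
  exact Hn.
Qed.

Lemma geometric_bound_zero x K r : (0 <= r < 1)%R -> (forall n : nat, (Cmod x <= K * r ^ n)%R) -> x = 0.
Proof.
intros Hr H. apply Cmod_eq_0, Rle_antisym; [|apply Cmod_ge_0].
apply le_epsilon. intros eps He. destruct (pow_small K r eps Hr He) as [n Hn].
specialize (H n). lra.
Qed.

Lemma geometric_bound_eq x y K r : (0 <= r < 1)%R ->
  (forall n : nat, (Cmod (x - y) <= K * r ^ n)%R) -> x = y.
Proof.
intros Hr H. replace x with (x - y + y) by ring.
rewrite (geometric_bound_zero (x - y) K r Hr H). ring.
Qed.

Lemma geometric_cauchy (u : nat -> C) K r : (0 <= r < 1)%R -> (0 <= K)%R ->
  (forall n, (Cmod (u (S n) - u n) <= K * r ^ n)%R) ->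
  forall n m, (Cmod (u (n + m)%nat - u n) <= K / (1 - r) * r ^ n)%R.
Proof.
intros Hr HK H n m.
assert (Q : (0 <= K / (1 - r))%R) by (apply Rdiv_le_0_compat; lra).
enough (A : (Cmod (u (n + m)%nat - u n) <= K / (1 - r) * r ^ n * (1 - r ^ m))%R).
{ assert (0 <= K / (1 - r) * r ^ n)%R by (apply Rmult_le_pos; auto; apply pow_le; lra).
  assert (0 <= r ^ m)%R by (apply pow_le; lra). nra. }
induction m as [|m IH].
- rewrite Nat.add_0_r. replace (u n - u n) with (RtoC 0) by ring. rewrite Cmod_0. simpl. lra.
- replace (u (n + S m)%nat - u n) with ((u (S (n + m)) - u (n + m)%nat) + (u (n + m)%nat - u n))
    by (rewrite Nat.add_succ_r; ring).
  eapply Rle_trans; [apply Cmod_triangle|]. specialize (H (n + m)%nat).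
  rewrite pow_add in H. rewrite <- tech_pow_Rmult.
  replace (K / (1 - r) * r ^ n * (1 - r * r ^ m))%R
    with (K * (r ^ n * r ^ m) + K / (1 - r) * r ^ n * (1 - r ^ m))%R by (field; lra).
  lra.
Qed.

(** The completeness argument behind all the limits below, with the error
    bound from which locally uniform convergence is read off. *)
Lemma geometric_limit (u : nat -> C) K r : (0 <= r < 1)%R -> (0 <= K)%R ->
  (forall n, (Cmod (u (S n) - u n) <= K * r ^ n)%R) ->
  forall n, (Cmod (Clim_seq u - u n) <= 2 * (K / (1 - r)) * r ^ n)%R.
Proof.
intros Hr HK H. assert (CC := geometric_cauchy u K r Hr HK H).
set (Q := (K / (1 - r))%R) in *.
assert (HQ : (0 <= Q)%R) by (apply Rdiv_le_0_compat; lra).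
assert (Mono : forall n m, (n <= m)%nat -> (Cmod (u m - u n) <= Q * r ^ n)%R).
{ intros n m L. replace m with (n + (m - n))%nat by lia. apply CC. }
assert (Comp : forall p : C -> R, (forall a b, (Rabs (p a - p b) <= Cmod (a - b))%R) ->
  exists l : R, is_lim_seq (fun n => p (u n)) l).
{ intros p Hp.
  assert (E : ex_finite_lim_seq (fun n => p (u n))).
  { apply ex_lim_seq_cauchy_corr. intros eps.
    destruct (pow_small Q r (eps / 2)%R Hr) as [N HN]; [generalize (cond_pos eps); lra|].
    exists N. intros n m Hn Hm.
    replace (p (u n) - p (u m))%R with ((p (u n) - p (u N)) - (p (u m) - p (u N)))%R by ring.
    eapply Rle_lt_trans; [apply Rabs_triang|]. rewrite Rabs_Ropp.
    generalize (Hp (u n) (u N)) (Hp (u m) (u N)) (Mono N n Hn) (Mono N m Hm). lra. }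
  destruct E as [l Hl]. now exists l. }
destruct (Comp Re) as [l1 H1].
{ intros a b. replace (Re a - Re b)%R with (Re (a - b)) by (unfold Re; simpl; ring). apply re_le_Cmod. }
destruct (Comp Im) as [l2 H2].
{ intros a b. replace (Im a - Im b)%R with (Im (a - b)) by (unfold Im; simpl; ring). apply Im_le_Cmod. }
rewrite (Clim_seq_unique u (l1, l2)).
2:{ intros P [eps HP].
    apply is_lim_seq_spec in H1. apply is_lim_seq_spec in H2.
    destruct (H1 eps) as [N1 A1]. destruct (H2 eps) as [N2 A2].
    exists (max N1 N2). intros n Hn. apply HP. split; simpl.
    - apply A1. lia.
    - apply A2. lia. }
assert (Lc : forall (p : C -> R) (l : R), (forall a b, (Rabs (p a - p b) <= Cmod (a - b))%R) ->
  is_lim_seq (fun n => p (u n)) l -> forall n, (Rabs (l - p (u n)) <= Q * r ^ n)%R).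
{ intros p l Hp Hl n.
  assert (L : is_lim_seq (fun m => Rabs (p (u (m + n)%nat) - p (u n)))%R (Rabs (l - p (u n)))).
  { apply (is_lim_seq_abs _ (l - p (u n))%R).
    apply (is_lim_seq_minus' _ (fun _ => p (u n)) l (p (u n))).
    - now apply (is_lim_seq_incr_n (fun m => p (u m)) n).
    - apply is_lim_seq_const. }
  apply (is_lim_seq_le (fun m => Rabs (p (u (m + n)%nat) - p (u n)))%R (fun _ => Q * r ^ n)%R
    (Rabs (l - p (u n))) (Q * r ^ n)%R).
  - intros m. eapply Rle_trans; [apply Hp|]. apply Mono. lia.
  - exact L.
  - apply is_lim_seq_const. }
intros n.
eapply Rle_trans; [apply Cmod_le_Re_Im|].
assert (A1 := Lc Re l1). assert (A2 := Lc Im l2).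
assert (B1 : (Rabs (l1 - Re (u n)) <= Q * r ^ n)%R).
{ apply A1; auto. intros a b.
  replace (Re a - Re b)%R with (Re (a - b)) by (unfold Re; simpl; ring). apply re_le_Cmod. }
assert (B2 : (Rabs (l2 - Im (u n)) <= Q * r ^ n)%R).
{ apply A2; auto. intros a b.
  replace (Im a - Im b)%R with (Im (a - b)) by (unfold Im; simpl; ring). apply Im_le_Cmod. }
simpl. unfold Re, Im, Rminus in *. simpl. lra.
Qed.

(** * The q-Pochhammer symbol as a function of its first argument *)

Definition qfactor (a q : C) (i : nat) : C := 1 - a * q ^ i.

Lemma Cprod_qfactor_bound a q n : (Cmod q < 1)%R ->
  (Cmod (Cprod (qfactor a q) n) <= exp (Cmod a / (1 - Cmod q)))%R.
Proof.
intros Hq. assert (Hq0 := Cmod_ge_0 q). assert (Ha := Cmod_ge_0 a).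
assert (A : (Cmod (Cprod (qfactor a q) n) <= exp (Cmod a * ((1 - Cmod q ^ n) / (1 - Cmod q))))%R).
{ induction n as [|n IH].
  - simpl. rewrite Cmod_1. replace (Cmod a * ((1 - 1) / (1 - Cmod q)))%R with 0%R by (field; lra).
    rewrite exp_0. lra.
  - simpl Cprod. rewrite Cmod_mult.
    replace (Cmod a * ((1 - Cmod q ^ S n) / (1 - Cmod q)))%R
      with (Cmod a * ((1 - Cmod q ^ n) / (1 - Cmod q)) + Cmod a * Cmod q ^ n)%R
      by (rewrite <- tech_pow_Rmult; field; lra).
    rewrite exp_plus. apply Rmult_le_compat; auto using Cmod_ge_0.
    unfold qfactor, Cminus. eapply Rle_trans; [apply Cmod_triangle|].
    rewrite Cmod_opp, Cmod_mult, Cmod_pow, Cmod_1. apply exp_ineq1_le. }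
eapply Rle_trans; [exact A|].
assert (L : (Cmod a * ((1 - Cmod q ^ n) / (1 - Cmod q)) <= Cmod a / (1 - Cmod q))%R).
{ unfold Rdiv. apply Rmult_le_compat_l; [exact Ha|].
  rewrite <- (Rmult_1_l (/ (1 - Cmod q))) at 2. apply Rmult_le_compat_r.
  - apply Rlt_le, Rinv_0_lt_compat. lra.
  - assert (0 <= Cmod q ^ n)%R by (apply pow_le; lra). lra. }
destruct L as [L | ->]; [left; now apply exp_increasing | lra].
Qed.

(** Error constant of the partial products; being increasing in the modulus a, it is
    uniform on discs. *)
Definition qPoch_rate (a q : R) : R := (2 * (exp (a / (1 - q)) * a / (1 - q)))%R.

Lemma qPoch_rate_incr a b q : (0 <= q < 1)%R -> (0 <= a <= b)%R -> (0 <= qPoch_rate a q <= qPoch_rate b q)%R.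
Proof.
intros Hq Hab. unfold qPoch_rate, Rdiv.
assert (I : (0 < / (1 - q))%R) by (apply Rinv_0_lt_compat; lra).
assert (E : (exp (a * / (1 - q)) <= exp (b * / (1 - q)))%R).
{ destruct (Rle_lt_or_eq_dec a b) as [L| ->]; [lra | | lra].
  left. apply exp_increasing. apply Rmult_lt_compat_r; lra. }
assert (P := exp_pos (a * / (1 - q))%R).
assert (0 <= exp (a * / (1 - q)) * a)%R by (apply Rmult_le_pos; lra).
assert (exp (a * / (1 - q)) * a <= exp (b * / (1 - q)) * b)%R
  by (apply Rmult_le_compat; lra).
split.
- apply Rmult_le_pos; [lra|]. apply Rmult_le_pos; lra.
- apply Rmult_le_compat_l; [lra|]. apply Rmult_le_compat_r; lra.
Qed.

Lemma qPochhammer_approx a q n : (Cmod q < 1)%R ->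
  (Cmod (qPochhammer a q - Cprod (qfactor a q) n) <= qPoch_rate (Cmod a) (Cmod q) * Cmod q ^ n)%R.
Proof.
intros Hq. assert (Hq0 := Cmod_ge_0 q). unfold qPochhammer, qPoch_rate.
apply (geometric_limit (Cprod (qfactor a q))); [lra | |].
- apply Rmult_le_pos; [apply Rlt_le, exp_pos | apply Cmod_ge_0].
- intros k. simpl. replace (Cprod (qfactor a q) k * qfactor a q k - Cprod (qfactor a q) k)
    with (- (Cprod (qfactor a q) k * (a * q ^ k))) by (unfold qfactor; ring).
  rewrite Cmod_opp, !Cmod_mult, Cmod_pow, Rmult_assoc.
  apply Rmult_le_compat_r; [|now apply Cprod_qfactor_bound].
  apply Rmult_le_pos; [apply Cmod_ge_0 | apply pow_le; lra].
Qed.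

Lemma entire_qPochhammer q : (Cmod q < 1)%R -> entire (fun a => qPochhammer a q).
Proof.
intros Hq. assert (Hq0 := Cmod_ge_0 q). apply entire_limit. intros r eps He.
destruct (pow_small (qPoch_rate (Rabs r) (Cmod q)) (Cmod q) eps) as [n Hn]; [lra | exact He|].
exists (fun a => Cprod (qfactor a q) n). split.
- clear Hn. induction n as [|n IH]; simpl; [apply entire_const|].
  apply entire_mult; [exact IH|]. apply (entire_ext (fun a => 1 + (- q ^ n) * a)).
  + intros z. unfold qfactor. ring.
  + apply entire_affine.
- intros a Ha. eapply Rle_trans; [now apply qPochhammer_approx|].
  apply Rlt_le. eapply Rle_lt_trans; [|exact Hn]. apply Rmult_le_compat_r; [apply pow_le; lra|].
  apply qPoch_rate_incr; [lra|]. generalize (Cmod_ge_0 a) (RRle_abs r). lra.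
Qed.

Lemma Cprod_qfactor_shift a q n :
  Cprod (qfactor a q) (S n) = (1 - a) * Cprod (qfactor (a * q) q) n.
Proof.
induction n as [|n IH]; [simpl; unfold qfactor; simpl; ring|].
change (Cprod (qfactor a q) (S (S n))) with (Cprod (qfactor a q) (S n) * qfactor a q (S n)).
rewrite IH. simpl. unfold qfactor. simpl. ring.
Qed.

Lemma qPochhammer_rec a q : (Cmod q < 1)%R ->
  qPochhammer a q = (1 - a) * qPochhammer (a * q) q.
Proof.
intros Hq. assert (Hq0 := Cmod_ge_0 q).
apply (geometric_bound_eq _ _ (qPoch_rate (Cmod a) (Cmod q) * Cmod q
  + Cmod (1 - a) * qPoch_rate (Cmod (a * q)) (Cmod q)) (Cmod q)); [lra|].
intros n.
assert (A := qPochhammer_approx a q (S n) Hq). assert (B := qPochhammer_approx (a * q) q n Hq).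
rewrite Cprod_qfactor_shift in A.
replace (qPochhammer a q - (1 - a) * qPochhammer (a * q) q)
  with ((qPochhammer a q - (1 - a) * Cprod (qfactor (a * q) q) n)
        + - ((1 - a) * (qPochhammer (a * q) q - Cprod (qfactor (a * q) q) n))) by ring.
eapply Rle_trans; [apply Cmod_triangle|]. rewrite Cmod_opp, (Cmod_mult (1 - a)).
rewrite <- tech_pow_Rmult in A.
apply (Rmult_le_compat_l (Cmod (1 - a))) in B; [|apply Cmod_ge_0]. lra.
Qed.

Lemma Cmod_lt_1_neq a : (Cmod a < 1)%R -> 1 - a <> 0.
Proof.
intros Ha E. assert (a = 1) by (replace a with (1 - (1 - a)) by ring; rewrite E; ring).
subst. rewrite Cmod_1 in Ha. lra.
Qed.

(** Peel off enough factors that the remaining tail is close to 1. *)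
Lemma qPochhammer_neq0 a q : (Cmod q < 1)%R -> (Cmod a < 1)%R -> qPochhammer a q <> 0.
Proof.
intros Hq Ha. assert (Hq0 := Cmod_ge_0 q). assert (Ha0 := Cmod_ge_0 a).
set (K := (2 * (exp (1 / (1 - Cmod q)) / (1 - Cmod q)))%R).
(* K |q|^n dominates the distance from 1 of the tail starting at a q^n. *)
destruct (pow_small K (Cmod q) 1) as [n Hn]; [lra | lra |].
assert (HK : (0 < K)%R).
{ unfold K. apply Rmult_lt_0_compat; [lra|]. apply Rdiv_lt_0_compat; [apply exp_pos | lra]. }
assert (Tail : forall k a, (Cmod a < 1)%R -> qPochhammer (a * q ^ k) q <> 0 -> qPochhammer a q <> 0).
{ clear - Hq Hq0. induction k as [|k IH]; intros a Ha H.
  - simpl in H. now rewrite Cmult_1_r in H.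
  - rewrite qPochhammer_rec by exact Hq. apply Cmult_neq_0; [now apply Cmod_lt_1_neq|].
    apply IH.
    + rewrite Cmod_mult. generalize (Cmod_ge_0 a). nra.
    + replace (a * q * q ^ k) with (a * q ^ S k) by (rewrite Cpow_S; ring). exact H. }
apply (Tail n); [exact Ha|].
set (b := a * q ^ n). assert (Hb : (Cmod b <= Cmod q ^ n)%R).
{ unfold b. rewrite Cmod_mult, Cmod_pow. assert (0 <= Cmod q ^ n)%R by (apply pow_le; lra). nra. }
assert (Q1 : (Cmod q ^ n <= 1)%R).
{ rewrite <- (pow1 n). apply pow_incr. lra. }
intros E. assert (A := qPochhammer_approx b q 0 Hq). rewrite E in A. simpl in A.
replace (RtoC 0 - RtoC 1) with (- (1))%C in A by ring. rewrite Cmod_opp, Cmod_1, Rmult_1_r in A.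
assert (B := qPoch_rate_incr (Cmod b) (Cmod q ^ n) (Cmod q) ltac:(lra) ltac:(generalize (Cmod_ge_0 b); lra)).
assert (D : (qPoch_rate (Cmod q ^ n) (Cmod q) <= K * Cmod q ^ n)%R); [|lra].
unfold qPoch_rate, K. unfold Rdiv.
replace (2 * (exp (1 * / (1 - Cmod q)) * / (1 - Cmod q)) * Cmod q ^ n)%R
  with (2 * (exp (1 * / (1 - Cmod q)) * Cmod q ^ n * / (1 - Cmod q)))%R by ring.
assert (I : (0 < / (1 - Cmod q))%R) by (apply Rinv_0_lt_compat; lra).
apply Rmult_le_compat_l; [lra|]. apply Rmult_le_compat_r; [lra|].
apply Rmult_le_compat_r; [apply pow_le; lra|].
destruct Q1 as [Q1 | ->]; [|lra].
left. apply exp_increasing. apply Rmult_lt_compat_r; lra.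
Qed.

(** * The theta product *)

Lemma Cmod_nome sigma : Cmod (nome sigma) = exp (- (PI * Im sigma)).
Proof.
unfold nome. rewrite Cmod_Cexp. f_equal. destruct sigma as [x y]. simpl. ring.
Qed.

Lemma Cmod_nome_lt_1 sigma : (0 < Im sigma)%R -> (Cmod (nome sigma) < 1)%R.
Proof.
intros H. rewrite Cmod_nome, <- exp_0. apply exp_increasing. generalize PI_RGT_0. nra.
Qed.

Lemma Cmod_sqr_lt_1 q : (Cmod q < 1)%R -> (Cmod (q ^ 2) < 1)%R.
Proof. intros H. rewrite Cmod_pow. generalize (Cmod_ge_0 q). simpl. nra. Qed.

(** Splitting off the sine leaves a factor whose value at 0 is the derivative of the
    product there. *)
Definition theta_cofactor (sigma z : C) : C :=
  qPochhammer (nome sigma ^ 2 * Cexp (2 * Ci * z)) (nome sigma ^ 2) *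
  qPochhammer (nome sigma ^ 2 * Cexp (- (2 * Ci * z))) (nome sigma ^ 2).

Definition theta_prod (sigma z : C) : C := Csin z * theta_cofactor sigma z.

Lemma entire_theta_cofactor sigma : (0 < Im sigma)%R -> entire (theta_cofactor sigma).
Proof.
intros H. assert (Hq := Cmod_sqr_lt_1 _ (Cmod_nome_lt_1 sigma H)).
apply entire_mult; apply (entire_comp (fun a => qPochhammer a (nome sigma ^ 2)));
  try (now apply entire_qPochhammer); apply entire_scal, entire_Cexp_comp.
- apply entire_scal, entire_id.
- apply (entire_ext (fun z => (- (2 * Ci)) * z)); [intros z; ring | apply entire_scal, entire_id].
Qed.

Lemma Csin_plus_PI z : Csin (z + PI) = - Csin z.
Proof.
unfold Csin. replace (Ci * (z + PI)) with (Ci * z + PI * Ci) by ring.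
replace (- (Ci * z + PI * Ci)) with (- (Ci * z) + - (PI * Ci)) by ring.
rewrite !Cexp_plus, (Cexp_opp (PI * Ci)), Cexp_PI_Ci.
replace (/ - (1)) with (- (1)) by (field; intros E; apply (f_equal fst) in E; simpl in E; lra).
unfold Cdiv. ring.
Qed.

Lemma Csin_opp z : Csin (- z) = - Csin z.
Proof.
unfold Csin. replace (Ci * - z) with (- (Ci * z)) by ring.
replace (- - (Ci * z)) with (Ci * z) by ring. unfold Cdiv. ring.
Qed.

Lemma two_Ci_neq0 : 2 * Ci <> 0.
Proof. intros E. apply (f_equal snd) in E. simpl in E. lra. Qed.

Lemma Csin_factor z : Csin z = - (Cexp (- (Ci * z)) / (2 * Ci)) * (1 - Cexp (2 * Ci * z)).
Proof.
unfold Csin.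
replace (Cexp (2 * Ci * z)) with (Cexp (Ci * z) * Cexp (Ci * z))
  by (rewrite <- Cexp_plus; f_equal; ring).
rewrite Cexp_opp. field. repeat split; first [apply Cexp_neq0 | apply Ci_nz].
Qed.

Lemma theta_cofactor_opp sigma z : theta_cofactor sigma (- z) = theta_cofactor sigma z.
Proof.
unfold theta_cofactor. replace (2 * Ci * - z) with (- (2 * Ci * z)) by ring.
replace (- - (2 * Ci * z)) with (2 * Ci * z) by ring. ring.
Qed.

Lemma theta_prod_opp sigma z : theta_prod sigma (- z) = - theta_prod sigma z.
Proof. unfold theta_prod. rewrite Csin_opp, theta_cofactor_opp. ring. Qed.

(** Adding pi sigma to z multiplies w = e^(2iz) by q^2: the factors of the two
    infinite products move by one place, and 1 - w is exchanged with 1 - 1/w. *)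
Lemma theta_prod_theta_fun sigma : (0 < Im sigma)%R ->
  theta_fun 1 sigma (- Cexp (- (PI * Ci * sigma))) (theta_prod sigma).
Proof.
intros H. assert (Hq := Cmod_sqr_lt_1 _ (Cmod_nome_lt_1 sigma H)). split.
- apply entire_mult; [apply entire_Csin | now apply entire_theta_cofactor].
- intros z. unfold theta_prod, theta_cofactor. rewrite Csin_plus_PI.
  replace (Cexp (2 * Ci * (z + PI))) with (Cexp (2 * Ci * z)).
  2:{ replace (2 * Ci * (z + PI)) with (2 * Ci * z + 2 * PI * Ci * IZR 1) by ring.
      rewrite Cexp_plus, Cexp_2PI_Ci. ring. }
  rewrite Cexp_opp.
  replace (Cexp (2 * Ci * (z + PI))) with (Cexp (2 * Ci * z)).
  2:{ replace (2 * Ci * (z + PI)) with (2 * Ci * z + 2 * PI * Ci * IZR 1) by ring.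
      rewrite Cexp_plus, Cexp_2PI_Ci. ring. }
  rewrite Cexp_opp. ring.
- intros z. unfold theta_prod, theta_cofactor. rewrite !Csin_factor.
  set (p := nome sigma ^ 2) in *. set (w := Cexp (2 * Ci * z)).
  assert (Hw : w <> 0) by apply Cexp_neq0.
  assert (Hp : p = Cexp (2 * Ci * (PI * sigma))).
  { unfold p, nome. rewrite Cexp_pow. f_equal. change (INR 2) with (1 + 1)%R. rewrite RtoC_plus. ring. }
  assert (Hp0 : p <> 0) by (rewrite Hp; apply Cexp_neq0).
  rewrite !Cexp_opp. replace (2 * Ci * (z + PI * sigma)) with (2 * Ci * z + 2 * Ci * (PI * sigma)) by ring.
  rewrite Cexp_plus. fold w. rewrite <- Hp.
  replace (Ci * (z + PI * sigma)) with (Ci * z + PI * Ci * sigma) by ring. rewrite Cexp_plus.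
  replace (2 * INR 1 * Ci * z) with (2 * Ci * z) by (change (INR 1) with 1%R; ring). fold w.
  rewrite (qPochhammer_rec (p * w) p Hq).
  replace (p * / (w * p)) with (/ w) by (field; auto).
  rewrite (qPochhammer_rec (/ w) p Hq).
  replace (/ w * p) with (p * / w) by ring. replace (p * w * p) with (p * (w * p)) by ring.
  field. repeat split; auto using Cexp_neq0, Ci_nz.
Qed.

Lemma theta_cofactor_0_neq0 sigma : (0 < Im sigma)%R -> theta_cofactor sigma 0 <> 0.
Proof.
intros H. assert (Hq := Cmod_sqr_lt_1 _ (Cmod_nome_lt_1 sigma H)).
unfold theta_cofactor. replace (2 * Ci * 0) with (RtoC 0) by ring.
replace (- RtoC 0) with (RtoC 0) by ring. rewrite Cexp_0, Cmult_1_r.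
apply Cmult_neq_0; now apply qPochhammer_neq0.
Qed.

Lemma Csin_PI2 : Csin (PI / 2) = 1.
Proof.
unfold Csin.
replace (Cexp (Ci * (PI / 2))) with Ci.
2:{ unfold Cexp, Re, Im.
    replace (Ci * (PI / 2))%C with (0, PI / 2)%R.
    - simpl. rewrite exp_0, cos_PI2, sin_PI2. apply injective_projections; simpl; ring.
    - rewrite <- (RtoC_div PI 2) by lra. apply injective_projections; simpl; ring. }
replace (Cexp (- (Ci * (PI / 2)))) with (- Ci).
2:{ unfold Cexp, Re, Im.
    replace (- (Ci * (PI / 2)))%C with (0, - (PI / 2))%R.
    - simpl. rewrite exp_0, cos_neg, sin_neg, cos_PI2, sin_PI2. apply injective_projections; simpl; ring.
    - rewrite <- (RtoC_div PI 2) by lra. apply injective_projections; simpl; ring. }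
field. apply Ci_nz.
Qed.

Lemma theta_prod_PI2_neq0 sigma : (0 < Im sigma)%R -> theta_prod sigma (PI / 2) <> 0.
Proof.
intros H. assert (Hq := Cmod_sqr_lt_1 _ (Cmod_nome_lt_1 sigma H)).
unfold theta_prod, theta_cofactor. rewrite Csin_PI2, Cmult_1_l.
replace (2 * Ci * (PI / 2)) with (PI * Ci) by field.
rewrite Cexp_opp, Cexp_PI_Ci.
apply Cmult_neq_0; apply qPochhammer_neq0; auto; rewrite Cmod_mult.
- rewrite Cmod_m1. lra.
- rewrite Cmod_inv, Cmod_m1 by (intros E; apply (f_equal fst) in E; simpl in E; lra). lra.
Qed.

(** * The theta series *)

(** The sine series folded at its centre: in the bilateral series of exponentials
    theta_plus is the term of index n and - theta_minus the one of index - n - 1. *)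
Definition theta_plus (sigma z : C) (n : nat) : C :=
  (- (1)) ^ n * Cexp (PI * Ci * sigma * RtoC (INR (2 * n + 1)) ^ 2 / 4 + Ci * (RtoC (INR (2 * n + 1)) * z)).
Definition theta_minus (sigma z : C) (n : nat) : C := theta_plus sigma (- z) n.

Definition theta_term (sigma z : C) (n : nat) : C := (theta_plus sigma z n - theta_minus sigma z n) / (2 * Ci).

Lemma theta1_sum z sigma : theta1 z sigma = 2 * Clim_seq (fun n => sum_n (theta_term sigma z) n).
Proof.
unfold theta1, CSeries. f_equal. f_equal.
apply functional_extensionality. intros n.
apply sum_n_ext. intros k. unfold theta_term, theta_minus, theta_plus, Csin. cbv zeta.
match goal with |- ?a = ?b => change (@eq C a b) end.
set (j := RtoC (INR (2 * k + 1))). rewrite !Cexp_plus.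
replace (Ci * (j * - z)) with (- (Ci * (j * z))) by ring.
field. apply Ci_nz.
Qed.

Lemma Csum_O (a : nat -> C) : sum_n a 0 = a 0%nat :> C.
Proof. exact (sum_O a). Qed.

Lemma Csum_S (a : nat -> C) n : sum_n a (S n) = sum_n a n + a (S n) :> C.
Proof. exact (sum_Sn a n). Qed.

(** With k = 2n+1 and c = pi Im(sigma), completing the square bounds the exponent
    - c k^2/4 + k r by (r+1)^2/c - k. *)
Definition theta_rate (sigma : C) (r : R) : R := exp ((r + 1) ^ 2 / (PI * Im sigma)).

Lemma theta_plus_bound sigma z n r : (0 < Im sigma)%R -> (Cmod z <= r)%R ->
  (Cmod (theta_plus sigma z n) <= theta_rate sigma r * exp (-1) ^ n)%R.
Proof.
intros H Hz. unfold theta_plus. rewrite Cmod_mult, Cmod_pow, Cmod_m1, pow1, Rmult_1_l, Cmod_Cexp.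
set (k := INR (2 * n + 1)).
assert (Hk : (INR n + 1 <= k)%R).
{ unfold k. rewrite plus_INR, mult_INR. simpl. generalize (pos_INR n). lra. }
assert (E : Re (PI * Ci * sigma * RtoC k ^ 2 / 4 + Ci * (RtoC k * z))
  = (- (PI * Im sigma) * k ^ 2 / 4 - k * Im z)%R).
{ replace (RtoC 4) with (RtoC 4) by reflexivity. unfold Cdiv. rewrite <- RtoC_inv by lra.
  rewrite <- RtoC_pow. destruct sigma, z. unfold Re, Im. simpl. field. }
rewrite E, exp_INR_mult. unfold theta_rate. rewrite <- exp_plus.
assert (Hi : (- Im z <= r)%R) by (generalize (Im_le_Cmod z) (Rabs_maj2 (Im z)); lra).
assert (L : (- (PI * Im sigma) * k ^ 2 / 4 - k * Im z <= (r + 1) ^ 2 / (PI * Im sigma) + INR n * -1)%R).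
2:{ destruct L as [L| ->]; [left; now apply exp_increasing | lra]. }
set (c := (PI * Im sigma)%R). assert (Hc : (0 < c)%R) by (unfold c; generalize PI_RGT_0; nra).
assert (S : (0 <= (c * k / 2 - (r + 1)) ^ 2 / c)%R).
{ apply Rdiv_le_0_compat; [apply pow2_ge_0 | exact Hc]. }
replace ((c * k / 2 - (r + 1)) ^ 2 / c)%R with (c * k ^ 2 / 4 - k * (r + 1) + (r + 1) ^ 2 / c)%R in S
  by (field; lra).
generalize (pos_INR n). nra.
Qed.

Lemma exp_m1_bound : (0 <= exp (-1) < 1)%R.
Proof.
split; [apply Rlt_le, exp_pos|]. rewrite <- exp_0. apply exp_increasing. lra.
Qed.

Lemma theta_term_bound sigma z n r : (0 < Im sigma)%R -> (Cmod z <= r)%R ->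
  (Cmod (theta_term sigma z n) <= theta_rate sigma r * exp (-1) ^ n)%R.
Proof.
intros H Hz. unfold theta_term, theta_minus. rewrite Cmod_div, Cmod_mult, Cmod_Ci, Cmod_R by apply two_Ci_neq0.
rewrite Rabs_pos_eq by lra.
assert (A := theta_plus_bound sigma z n r H Hz).
assert (B := theta_plus_bound sigma (- z) n r H ltac:(rewrite Cmod_opp; exact Hz)).
assert (D : (Cmod (theta_plus sigma z n - theta_plus sigma (- z) n) <= 2 * (theta_rate sigma r * exp (-1) ^ n))%R).
{ unfold Cminus. eapply Rle_trans; [apply Cmod_triangle|]. rewrite Cmod_opp. lra. }
lra.
Qed.

Lemma sum_theta_term_approx sigma z r n : (0 < Im sigma)%R -> (Cmod z <= r)%R ->
  (Cmod (Clim_seq (fun n => sum_n (theta_term sigma z) n) - sum_n (theta_term sigma z) n)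
    <= 2 * (theta_rate sigma r / (1 - exp (-1))) * exp (-1) ^ n)%R.
Proof.
intros H Hz. assert (E := exp_m1_bound).
apply (geometric_limit (fun n => sum_n (theta_term sigma z) n)); [exact E | apply Rlt_le, exp_pos|].
intros k. rewrite Csum_S.
replace (sum_n (theta_term sigma z) k + theta_term sigma z (S k) - sum_n (theta_term sigma z) k)
  with (theta_term sigma z (S k)) by ring.
eapply Rle_trans; [apply (theta_term_bound sigma z (S k) r H Hz)|].
apply Rmult_le_compat_l; [apply Rlt_le, exp_pos|].
rewrite <- tech_pow_Rmult. assert (0 <= exp (-1) ^ k)%R by (apply pow_le; lra). nra.
Qed.

Lemma entire_theta_plus sigma n : entire (fun z => theta_plus sigma z n).
Proof.
apply entire_scal, entire_Cexp_comp.
apply entire_plus; [apply entire_const|]. do 2 apply entire_scal. apply entire_id.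
Qed.

Lemma entire_theta1 sigma : (0 < Im sigma)%R -> entire (fun z => theta1 z sigma).
Proof.
intros H. apply (entire_ext (fun z => 2 * Clim_seq (fun n => sum_n (theta_term sigma z) n))).
{ intros z. now rewrite theta1_sum. }
apply entire_scal, entire_limit. intros r eps He.
destruct (pow_small (2 * (theta_rate sigma r / (1 - exp (-1)))) (exp (-1)) eps exp_m1_bound He) as [n Hn].
exists (fun z => sum_n (theta_term sigma z) n). split.
- assert (T : forall k, entire (fun z => theta_term sigma z k)).
  { intros k. apply (entire_ext (fun z => / (2 * Ci) * (theta_plus sigma z k - theta_plus sigma (- z) k))).
    - intros z. unfold theta_term, theta_minus, Cdiv. ring.
    - apply entire_scal, entire_minus; [apply entire_theta_plus|].
      apply (entire_comp (fun z => theta_plus sigma z k)); [apply entire_theta_plus|].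
      apply (entire_ext (fun z => - (1) * z)); [intros z; ring | apply entire_scal, entire_id]. }
  clear Hn. induction n as [|n IH].
  + apply (entire_ext (fun z => theta_term sigma z 0)); [intros z; now rewrite Csum_O | apply T].
  + apply (entire_ext (fun z => sum_n (theta_term sigma z) n + theta_term sigma z (S n)));
      [intros z; now rewrite Csum_S | apply entire_plus; auto].
- intros z Hz. eapply Rle_trans; [apply (sum_theta_term_approx sigma z r n H Hz)|]. lra.
Qed.

Lemma theta_plus_pi sigma z n : theta_plus sigma (z + PI) n = - theta_plus sigma z n.
Proof.
unfold theta_plus. set (k := INR (2 * n + 1)).
replace (PI * Ci * sigma * k ^ 2 / 4 + Ci * (k * (z + PI)))
  with ((PI * Ci * sigma * k ^ 2 / 4 + Ci * (k * z)) + (PI * Ci + 2 * PI * Ci * IZR (Z.of_nat n))).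
- rewrite Cexp_plus, (Cexp_plus (PI * Ci)), Cexp_PI_Ci, Cexp_2PI_Ci. ring.
- rewrite <- INR_IZR_INZ. unfold k. rewrite plus_INR, mult_INR, RtoC_plus, RtoC_mult. simpl INR.
  replace (RtoC (1 + 1)) with (RtoC 2) by (f_equal; ring). field.
Qed.

Lemma theta_plus_omega sigma z n : theta_plus sigma (z + PI * sigma) n
  = - (Cexp (- (PI * Ci * sigma)) * Cexp (- (2 * INR 1 * Ci * z))) * theta_plus sigma z (S n).
Proof.
unfold theta_plus. rewrite (Cpow_S _ n), <- Cexp_plus.
replace (RtoC (INR (2 * S n + 1))) with (RtoC (INR (2 * n + 1)) + 2).
2:{ rewrite <- RtoC_plus. f_equal. rewrite !plus_INR, !mult_INR, (S_INR n). simpl. ring. }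
set (k := RtoC (INR (2 * n + 1))).
transitivity ((- (1)) ^ n * (Cexp (- (PI * Ci * sigma) + - (2 * INR 1 * Ci * z))
  * Cexp (PI * Ci * sigma * (k + 2) ^ 2 / 4 + Ci * ((k + 2) * z)))); [|ring].
rewrite <- Cexp_plus. do 2 f_equal. simpl. field.
Qed.

Lemma theta_minus_omega_0 sigma z : theta_minus sigma (z + PI * sigma) 0
  = Cexp (- (PI * Ci * sigma)) * Cexp (- (2 * INR 1 * Ci * z)) * theta_plus sigma z 0.
Proof.
unfold theta_minus, theta_plus. simpl. rewrite <- Cexp_plus, !Cmult_1_l, <- Cexp_plus.
f_equal. field.
Qed.

Lemma theta_minus_omega sigma z n : theta_minus sigma (z + PI * sigma) (S n)
  = - (Cexp (- (PI * Ci * sigma)) * Cexp (- (2 * INR 1 * Ci * z))) * theta_minus sigma z n.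
Proof.
unfold theta_minus, theta_plus. rewrite (Cpow_S _ n), <- Cexp_plus.
replace (RtoC (INR (2 * S n + 1))) with (RtoC (INR (2 * n + 1)) + 2).
2:{ rewrite <- RtoC_plus. f_equal. rewrite !plus_INR, !mult_INR, (S_INR n). simpl. ring. }
set (k := RtoC (INR (2 * n + 1))).
transitivity (- (1) * (- (1)) ^ n * (Cexp (- (PI * Ci * sigma) + - (2 * INR 1 * Ci * z))
  * Cexp (PI * Ci * sigma * k ^ 2 / 4 + Ci * (k * - z)))); [|ring].
rewrite <- Cexp_plus. do 2 f_equal. simpl. field.
Qed.

(** Adding pi sigma to z moves the bilateral series by one place; a symmetric
    partial sum picks up one new term at each end. *)
Lemma sum_theta_term_omega sigma z n :
  sum_n (theta_term sigma (z + PI * sigma)) n = - (Cexp (- (PI * Ci * sigma)) * Cexp (- (2 * INR 1 * Ci * z)))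
    * (sum_n (theta_term sigma z) n + (theta_plus sigma z (S n) + theta_minus sigma z n) / (2 * Ci)) :> C.
Proof.
set (M := Cexp (- (PI * Ci * sigma)) * Cexp (- (2 * INR 1 * Ci * z))).
induction n as [|n IH].
- rewrite !Csum_O. unfold theta_term. rewrite theta_plus_omega, theta_minus_omega_0. fold M.
  unfold Cdiv. ring.
- rewrite !Csum_S, IH. unfold theta_term.
  rewrite theta_plus_omega, theta_minus_omega. fold M. unfold Cdiv. ring.
Qed.

Lemma theta1_theta_fun sigma : (0 < Im sigma)%R ->
  theta_fun 1 sigma (- Cexp (- (PI * Ci * sigma))) (fun z => theta1 z sigma).
Proof.
intros H. split.
- now apply entire_theta1.
- intros z. rewrite !theta1_sum.
  transitivity (2 * - Clim_seq (fun n => sum_n (theta_term sigma z) n)); [f_equal|ring].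
  set (r := (Cmod z + PI)%R).
  apply (geometric_bound_eq _ _ (2 * (2 * (theta_rate sigma r / (1 - exp (-1))))) (exp (-1)) exp_m1_bound).
  intros n.
  assert (A := sum_theta_term_approx sigma z r n H ltac:(unfold r; generalize PI_RGT_0; lra)).
  assert (B : (Cmod (z + PI) <= r)%R).
  { eapply Rle_trans; [apply Cmod_triangle|]. rewrite Cmod_R, Rabs_pos_eq; [unfold r; lra|].
    generalize PI_RGT_0; lra. }
  apply (sum_theta_term_approx sigma _ r n H) in B.
  assert (E : sum_n (theta_term sigma (z + PI)) n = - sum_n (theta_term sigma z) n :> C).
  { clear A B. induction n as [|n IH].
    - rewrite !Csum_O. unfold theta_term, theta_minus.
      replace (- (z + PI)) with (- z + - PI) by ring.
      assert (P := theta_plus_pi sigma (- z + - PI) 0). replace (- z + - PI + PI) with (- z) in P by ring.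
      rewrite theta_plus_pi, P. unfold Cdiv. ring.
    - rewrite !Csum_S, IH. unfold theta_term, theta_minus.
      replace (- (z + PI)) with (- z + - PI) by ring.
      assert (P := theta_plus_pi sigma (- z + - PI) (S n)). replace (- z + - PI + PI) with (- z) in P by ring.
      rewrite theta_plus_pi, P. unfold Cdiv. ring. }
  rewrite E in B.
  set (X := Clim_seq (fun n => sum_n (theta_term sigma (z + PI)) n)) in *.
  set (Y := Clim_seq (fun n => sum_n (theta_term sigma z) n)) in *.
  set (Sn := sum_n (theta_term sigma z) n) in *.
  replace (X - - Y) with ((X - - Sn) + (Y - Sn)) by ring.
  eapply Rle_trans; [apply Cmod_triangle|]. lra.
- intros z. rewrite !theta1_sum.
  set (M := - (Cexp (- (PI * Ci * sigma)) * Cexp (- (2 * INR 1 * Ci * z)))).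
  transitivity (2 * (M * Clim_seq (fun n => sum_n (theta_term sigma z) n))); [f_equal|unfold M; ring].
  set (r := (Cmod z + Cmod (PI * sigma))%R).
  set (K := (2 * (theta_rate sigma r / (1 - exp (-1))))%R).
  apply (geometric_bound_eq _ _ (K + Cmod M * (K + theta_rate sigma r)) (exp (-1)) exp_m1_bound).
  intros n.
  assert (Hz : (Cmod z <= r)%R) by (unfold r; generalize (Cmod_ge_0 (PI * sigma)); lra).
  assert (A := sum_theta_term_approx sigma z r n H Hz). fold K in A.
  assert (B := sum_theta_term_approx sigma (z + PI * sigma) r n H (Cmod_triangle _ _)). fold K in B.
  rewrite sum_theta_term_omega in B. fold M in B.
  assert (D : (Cmod ((theta_plus sigma z (S n) + theta_minus sigma z n) / (2 * Ci)) <= theta_rate sigma r * exp (-1) ^ n)%R).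
  { rewrite Cmod_div, Cmod_mult, Cmod_Ci, Cmod_R, Rabs_pos_eq by (lra || apply two_Ci_neq0).
    assert (T1 := theta_plus_bound sigma z (S n) r H Hz).
    assert (T2 := theta_plus_bound sigma (- z) n r H ltac:(rewrite Cmod_opp; exact Hz)).
    fold (theta_minus sigma z n) in T2.
    assert (T3 : (theta_rate sigma r * exp (-1) ^ S n <= theta_rate sigma r * exp (-1) ^ n)%R).
    { apply Rmult_le_compat_l; [apply Rlt_le, exp_pos|]. rewrite <- tech_pow_Rmult.
      generalize exp_m1_bound. intros. assert (0 <= exp (-1) ^ n)%R by (apply pow_le; lra). nra. }
    assert (T4 := Cmod_triangle (theta_plus sigma z (S n)) (theta_minus sigma z n)). lra. }
  set (X := Clim_seq (fun n => sum_n (theta_term sigma (z + PI * sigma)) n)) in *.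
  set (Y := Clim_seq (fun n => sum_n (theta_term sigma z) n)) in *.
  set (Sn := sum_n (theta_term sigma z) n) in *.
  set (b := (theta_plus sigma z (S n) + theta_minus sigma z n) / (2 * Ci)) in *.
  replace (X - M * Y) with ((X - M * (Sn + b)) + M * (- (Y - Sn) + b)) by ring.
  eapply Rle_trans; [apply Cmod_triangle|]. rewrite Cmod_mult.
  assert (T5 := Cmod_triangle (- (Y - Sn)) b). rewrite Cmod_opp in T5.
  assert (Cmod M * Cmod (- (Y - Sn) + b) <= Cmod M * ((K + theta_rate sigma r) * exp (-1) ^ n))%R
    by (apply Rmult_le_compat_l; [apply Cmod_ge_0 | lra]).
  lra.
Qed.

(** Jacobi's triple product up to a constant. The constant may stay unknown, even
    zero, because the final identity is homogeneous in each theta function. *)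
Lemma theta1_prod sigma : (0 < Im sigma)%R ->
  exists c : C, forall z, theta1 z sigma = c * theta_prod sigma z.
Proof.
intros H.
apply (theta_fun_1_proportional sigma (- Cexp (- (PI * Ci * sigma)))
  (fun z => theta1 z sigma) (theta_prod sigma) (PI / 2)).
- intros E. apply (Cexp_neq0 (- (PI * Ci * sigma))).
  replace (Cexp (- (PI * Ci * sigma))) with (- - Cexp (- (PI * Ci * sigma))) by ring.
  rewrite E. ring.
- now apply theta1_theta_fun.
- now apply theta_prod_theta_fun.
- now apply theta_prod_PI2_neq0.
Qed.

(** * Comparing derivatives at the origin *)

Lemma Csin_taylor w : (Cmod w <= / 2)%R -> (Cmod (Csin w - w) <= 6 * Cmod w ^ 2)%R.
Proof.
intros Hw. unfold Csin.
replace ((Cexp (Ci * w) - Cexp (- (Ci * w))) / (2 * Ci) - w)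
  with (((Cexp (Ci * w) - 1 - Ci * w) + - (Cexp (- (Ci * w)) - 1 - - (Ci * w))) / (2 * Ci)).
2:{ field. apply Ci_nz. }
assert (Hi : Cmod (Ci * w) = Cmod w) by (rewrite Cmod_mult, Cmod_Ci; ring).
assert (A := Cexp_taylor2 (Ci * w) ltac:(rewrite Hi; exact Hw)).
assert (B := Cexp_taylor2 (- (Ci * w)) ltac:(rewrite Cmod_opp, Hi; exact Hw)).
rewrite Cmod_opp in B. rewrite Hi in A, B.
rewrite Cmod_div, Cmod_mult, Cmod_Ci, Cmod_R, Rabs_pos_eq by (lra || apply two_Ci_neq0).
assert (T := Cmod_triangle (Cexp (Ci * w) - 1 - Ci * w) (- (Cexp (- (Ci * w)) - 1 - - (Ci * w)))).
rewrite Cmod_opp in T. lra.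
Qed.

(** Division of both sides by z and passage to the limit at 0; it plays the role of
    equality of the derivatives at 0. *)
Lemma Csin_quotient_at_0 (a : C) F G : entire F -> entire G ->
  (forall z, Csin (a * z) * F z = Csin z * G z) -> a * F 0 = G 0.
Proof.
intros HF HG H.
set (D := fun z => a * F z - G z).
assert (HD : entire D) by (apply entire_minus; auto using entire_scal).
enough (E : D 0 = 0).
{ unfold D in E. replace (a * F 0) with (a * F 0 - G 0 + G 0) by ring. rewrite E. ring. }
apply Cmod_eq_0, Rle_antisym; [|apply Cmod_ge_0].
apply le_epsilon. intros eps He. rewrite Rplus_0_l.
destruct (entire_bounded F 1 HF) as [M [HM BM]].
destruct (entire_bounded G 1 HG) as [N [HN BN]].
destruct (entire_continuous D 0 (eps / 2) HD) as [d [Hd Cd]]; [lra|].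
assert (Ha := Cmod_ge_0 a).
set (K := (6 * Cmod a ^ 2 * M + 6 * N)%R).
assert (HK : (0 < K)%R) by (unfold K; generalize (pow2_ge_0 (Cmod a)); nra).
(* Three demands on h: continuity of D at 0, validity of the Taylor bounds at h and
   a h, and a resulting error h K below eps/2. *)
set (h := Rmin (d / 2) (Rmin (/ 2 / (1 + Cmod a)) (eps / 2 / K))).
assert (h0 : (0 < h)%R).
{ unfold h. repeat apply Rmin_glb_lt; try apply Rdiv_lt_0_compat; lra. }
assert (h1 : (h <= d / 2)%R) by apply Rmin_l.
assert (h2 : (h <= / 2 / (1 + Cmod a))%R) by (eapply Rle_trans; [apply Rmin_r | apply Rmin_l]).
assert (h3 : (h <= eps / 2 / K)%R) by (eapply Rle_trans; [apply Rmin_r | apply Rmin_r]).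
apply (Rmult_le_compat_r (1 + Cmod a)) in h2; [|lra].
unfold Rdiv in h2 at 1. rewrite Rmult_assoc, Rinv_l, Rmult_1_r in h2 by lra.
apply (Rmult_le_compat_r K) in h3; [|lra].
unfold Rdiv in h3 at 1. rewrite Rmult_assoc, Rinv_l, Rmult_1_r in h3 by lra.
assert (Ch : Cmod (RtoC h) = h) by (rewrite Cmod_R, Rabs_pos_eq; lra).
assert (S1 : (Cmod (Csin (a * h) - a * h) <= 6 * (Cmod a * h) ^ 2)%R).
{ rewrite <- Ch at 3. rewrite <- Cmod_mult. apply Csin_taylor. rewrite Cmod_mult, Ch. nra. }
assert (S2 : (Cmod (Csin h - h) <= 6 * h ^ 2)%R).
{ rewrite <- Ch at 3. apply Csin_taylor. rewrite Ch. nra. }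
assert (Eh : h * D h = - ((Csin (a * h) - a * h) * F h) + (Csin h - h) * G h).
{ unfold D. specialize (H h).
  replace (- ((Csin (a * h) - a * h) * F h) + (Csin h - h) * G h)
    with (- (Csin (a * h) * F h) + Csin h * G h + h * (a * F h - G h)) by ring.
  rewrite H. ring. }
assert (hN : (h <= 1)%R) by nra.
assert (Bh : (h * Cmod (D h) <= h * (h * K))%R).
{ rewrite <- Ch at 1. rewrite <- Cmod_mult, Eh.
  eapply Rle_trans; [apply Cmod_triangle|]. rewrite Cmod_opp, !Cmod_mult.
  specialize (BM h ltac:(rewrite Ch; exact hN)). specialize (BN h ltac:(rewrite Ch; exact hN)).
  assert (Cmod (Csin (a * h) - a * h) * Cmod (F h) <= (6 * (Cmod a * h) ^ 2) * M)%R
    by (apply Rmult_le_compat; auto using Cmod_ge_0).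
  assert (Cmod (Csin h - h) * Cmod (G h) <= (6 * h ^ 2) * N)%R
    by (apply Rmult_le_compat; auto using Cmod_ge_0).
  unfold K. lra. }
apply Rmult_le_reg_l in Bh; [|exact h0].
specialize (Cd h). replace (RtoC h - 0) with (RtoC h) in Cd by ring. rewrite Ch in Cd.
specialize (Cd ltac:(lra)).
replace (D 0) with (D h + - (D h - D 0)) by ring.
eapply Rle_trans; [apply Cmod_triangle|]. rewrite Cmod_opp. lra.
Qed.

(** * The modular transformation *)

Lemma Im_neg_inv tau : (0 < Im tau)%R -> tau <> 0 /\ (0 < Im (- (1) / tau))%R.
Proof.
intros H. assert (N : tau <> 0) by (intros E; rewrite E in H; simpl in H; lra).
split; [exact N|]. destruct tau as [x y]. simpl in H.
assert (P : (0 < x * (x * 1) + y * (y * 1))%R) by nra.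
replace (Im (- (1) / (x, y))) with (y / (x * (x * 1) + y * (y * 1)))%R.
- now apply Rdiv_lt_0_compat.
- unfold Cdiv, Cinv, Im. simpl. field. lra.
Qed.

(** The candidate for a multiple of theta_prod tau under the inversion of tau. *)
Definition modular_lift (tau z : C) : C :=
  Cexp (- (Ci / (PI * tau)) * z ^ 2) * theta_prod (- (1) / tau) (z / tau).

Lemma RtoC_PI_neq0 : RtoC PI <> 0.
Proof. intros E. apply RtoC_inj in E. generalize PI_RGT_0. lra. Qed.

(** The Gaussian factor turns the quasi-period pi of z/tau into an antiperiod and
    its antiperiod into a quasi-period. *)
Lemma modular_lift_theta_fun tau : (0 < Im tau)%R ->
  theta_fun 1 tau (- Cexp (- (PI * Ci * tau))) (modular_lift tau).
Proof.
intros H. destruct (Im_neg_inv tau H) as [N H']. assert (HP := RtoC_PI_neq0).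
assert (T := theta_prod_theta_fun _ H'). destruct T as [TE TP TO]. split.
- apply entire_mult.
  + apply entire_Cexp_comp, entire_scal, entire_pow, entire_id.
  + apply (entire_comp (theta_prod (- (1) / tau))); [exact TE|].
    apply (entire_ext (fun z => / tau * z)); [intros z; unfold Cdiv; ring | apply entire_scal, entire_id].
- intros z. unfold modular_lift.
  set (s := - (1) / tau) in *. set (v := (z + PI) / tau).
  assert (Ev : v + PI * s = z / tau) by (unfold v, s; field; exact N).
  specialize (TO v). rewrite Ev in TO. rewrite TO.
  transitivity (Cexp (- (Ci / (PI * tau)) * (z + PI) ^ 2) * theta_prod s v * 1); [ring|].
  replace (RtoC 1) with (Cexp (- (Ci / (PI * tau)) * z ^ 2 + - (PI * Ci * s) + - (2 * INR 1 * Ci * v)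
    + - (- (Ci / (PI * tau)) * (z + PI) ^ 2))).
  + rewrite !Cexp_plus, (Cexp_opp (- (Ci / (PI * tau)) * (z + PI) ^ 2)).
    field. apply Cexp_neq0.
  + rewrite <- Cexp_0. f_equal. unfold s, v. change (INR 1) with 1%R. field. auto.
- intros z. unfold modular_lift.
  replace ((z + PI * tau) / tau) with (z / tau + PI) by (field; exact N). rewrite TP.
  transitivity (- Cexp (- (Ci / (PI * tau)) * (z + PI * tau) ^ 2) * theta_prod (- (1) / tau) (z / tau)); [ring|].
  transitivity (- (Cexp (- (PI * Ci * tau)) * Cexp (- (2 * INR 1 * Ci * z))
    * Cexp (- (Ci / (PI * tau)) * z ^ 2)) * theta_prod (- (1) / tau) (z / tau)); [|ring].
  do 2 f_equal. rewrite <- !Cexp_plus. f_equal. change (INR 1) with 1%R. field. auto.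
Qed.

(** Compare the two sides of [modular_lift tau z = c * theta_prod tau z] to first
    order at z = 0, and at z = pi tau / 2, where the right side is the product
    in the denominator of PiQ; the constant c drops out. *)
Lemma theta_cofactor_modular tau : (0 < Im tau)%R ->
  theta_cofactor (- (1) / tau) 0
  = - (2 * Ci * tau) * PiQ tau * theta_prod (- (1) / tau) (PI / 2).
Proof.
intros H. destruct (Im_neg_inv tau H) as [N H']. assert (HP := RtoC_PI_neq0).
assert (Hn := Cmod_nome_lt_1 tau H). assert (Hq := Cmod_sqr_lt_1 _ Hn).
destruct (theta_fun_1_proportional tau (- Cexp (- (PI * Ci * tau)))
  (modular_lift tau) (theta_prod tau) (PI / 2)) as [c Hc].
- intros E. apply (Cexp_neq0 (- (PI * Ci * tau))).
  replace (Cexp (- (PI * Ci * tau))) with (- - Cexp (- (PI * Ci * tau))) by ring.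
  rewrite E. ring.
- now apply modular_lift_theta_fun.
- now apply theta_prod_theta_fun.
- now apply theta_prod_PI2_neq0.
- set (s := - (1) / tau) in *.
  assert (D0 : theta_cofactor s 0 = c * tau * theta_cofactor tau 0).
  { assert (D := Csin_quotient_at_0 (/ tau)
      (fun z => Cexp (- (Ci / (PI * tau)) * z ^ 2) * theta_cofactor s (/ tau * z))
      (fun z => c * theta_cofactor tau z)).
    cbv beta in D.
    replace (- (Ci / (PI * tau)) * 0 ^ 2) with (RtoC 0) in D by (simpl; ring).
    replace (/ tau * 0) with (RtoC 0) in D by ring.
    rewrite Cexp_0, Cmult_1_l in D.
    replace (c * tau * theta_cofactor tau 0) with (tau * (c * theta_cofactor tau 0)) by ring.
    rewrite <- D.
    - field. exact N.
    - apply entire_mult.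
      + apply entire_Cexp_comp, entire_scal, entire_pow, entire_id.
      + apply (entire_comp (theta_cofactor s)); [now apply entire_theta_cofactor |].
        apply entire_scal, entire_id.
    - now apply entire_scal, entire_theta_cofactor.
    - intros z. specialize (Hc z). unfold modular_lift, theta_prod in Hc. fold s in Hc.
      replace (z / tau) with (/ tau * z) in Hc by (unfold Cdiv; ring).
      transitivity (Cexp (- (Ci / (PI * tau)) * z ^ 2)
        * (Csin (/ tau * z) * theta_cofactor s (/ tau * z))); [ring|].
      rewrite Hc. ring. }
  specialize (Hc (PI * tau / 2)). unfold modular_lift in Hc. fold s in Hc.
  replace (PI * tau / 2 / tau) with (PI / 2) in Hc by (field; exact N).
  set (q := nome tau) in *.
  assert (Hq0 : q <> 0) by apply Cexp_neq0.
  set (x := Cexp (PI * Ci * tau * / 4)).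
  assert (Hx : x <> 0) by apply Cexp_neq0.
  replace (Cexp (- (Ci / (PI * tau)) * (PI * tau / 2) ^ 2)) with (/ x) in Hc.
  2:{ unfold x. rewrite <- Cexp_opp. f_equal. field. auto. }
  assert (Hqx : q = x * x * (x * x)).
  { unfold q, nome, x. rewrite <- !Cexp_plus. f_equal. field. }
  unfold theta_prod at 2 in Hc. unfold theta_cofactor in Hc. fold q in Hc.
  replace (2 * Ci * (PI * tau / 2)) with (PI * Ci * tau) in Hc by field.
  rewrite (Cexp_opp (PI * Ci * tau)) in Hc.
  change (Cexp (PI * Ci * tau)) with q in Hc.
  replace (q ^ 2 * / q) with q in Hc by (field; exact Hq0).
  assert (Sx : Csin (PI * tau / 2) = - (1 - q) / (2 * Ci * (x * x))).
  { rewrite Csin_factor. replace (2 * Ci * (PI * tau / 2)) with (PI * Ci * tau) by field.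
    change (Cexp (PI * Ci * tau)) with q. rewrite Cexp_opp.
    replace (Cexp (Ci * (PI * tau / 2))) with (x * x)
      by (unfold x; rewrite <- Cexp_plus; f_equal; field).
    field. split; [exact Hx | apply Ci_nz]. }
  rewrite Sx in Hc.
  set (A := qPochhammer q (q ^ 2)) in *.
  assert (HA : A <> 0) by now apply qPochhammer_neq0.
  assert (EA : A = (1 - q) * qPochhammer (q ^ 2 * q) (q ^ 2)).
  { unfold A. rewrite qPochhammer_rec by exact Hq. do 2 f_equal. ring. }
  assert (E0 : theta_cofactor tau 0 = qPochhammer (q ^ 2) (q ^ 2) ^ 2).
  { unfold theta_cofactor. fold q. replace (2 * Ci * 0) with (RtoC 0) by ring.
    replace (- RtoC 0) with (RtoC 0) by ring. rewrite Cexp_0, Cmult_1_r. ring. }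
  unfold PiQ, qpow. fold q. fold A. cbv zeta.
  replace (PI * Ci * tau * (1 / 4)) with (PI * Ci * tau * / 4) by field. fold x.
  assert (Ec : theta_prod s (PI / 2) = - c * A ^ 2 / (2 * Ci * x)).
  { transitivity (x * (/ x * theta_prod s (PI / 2))); [field; exact Hx|].
    rewrite Hc. set (B := qPochhammer (q ^ 2 * q) (q ^ 2)) in *.
    transitivity (- c * (((1 - q) * B) * A) / (2 * Ci * x)).
    - field. split; [exact Hx | apply Ci_nz].
    - rewrite <- EA. f_equal. ring. }
  rewrite D0, E0, Ec. field. repeat split; auto using Ci_nz.
Qed.

Lemma PiQ_neq0 tau : (0 < Im tau)%R -> PiQ tau <> 0.
Proof.
intros H. assert (Hn := Cmod_nome_lt_1 tau H). assert (Hq := Cmod_sqr_lt_1 _ Hn).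
unfold PiQ. apply Cmult_neq_0; [apply Cexp_neq0|].
unfold Cdiv. apply Cmult_neq_0.
- now apply Cpow_nz, qPochhammer_neq0.
- intros E.
  assert (B : qPochhammer (nome tau) (nome tau ^ 2) ^ 2 <> 0) by now apply Cpow_nz, qPochhammer_neq0.
  assert (F := Cinv_r _ B). rewrite E, Cmult_0_r in F. apply (f_equal fst) in F. simpl in F. lra.
Qed.

(** * The cubic relation *)

Lemma theta_prod_triple sigma : (0 < Im sigma)%R ->
  theta_fun 3 (3 * sigma) (- Cexp (- (9 * (PI * Ci * sigma)))) (theta_prod sigma).
Proof.
intros H. destruct (theta_prod_theta_fun sigma H) as [TE TP TO]. split; auto.
intros z. replace (z + PI * (3 * sigma)) with (z + PI * sigma + PI * sigma + PI * sigma) by ring.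
rewrite !TO.
transitivity (- (Cexp (- (PI * Ci * sigma)) * (Cexp (- (2 * INR 1 * Ci * (z + PI * sigma + PI * sigma)))
  * (Cexp (- (PI * Ci * sigma)) * (Cexp (- (2 * INR 1 * Ci * (z + PI * sigma)))
  * (Cexp (- (PI * Ci * sigma)) * Cexp (- (2 * INR 1 * Ci * z))))))) * theta_prod sigma z); [ring|].
transitivity (- (Cexp (- (9 * (PI * Ci * sigma))) * Cexp (- (2 * INR 3 * Ci * z))) * theta_prod sigma z); [|ring].
rewrite <- !Cexp_plus. do 3 f_equal. simpl INR. rewrite !RtoC_plus. ring.
Qed.

Lemma theta_prod_3z sigma : (0 < Im sigma)%R ->
  theta_fun 3 (3 * sigma) (- Cexp (- (9 * (PI * Ci * sigma)))) (fun z => theta_prod (9 * sigma) (3 * z)).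
Proof.
intros H. assert (H9 : (0 < Im (9 * sigma))%R) by (destruct sigma; simpl in *; lra).
destruct (theta_prod_theta_fun (9 * sigma) H9) as [TE TP TO]. split.
- apply (entire_comp (theta_prod (9 * sigma))); auto using entire_scal, entire_id.
- intros z. replace (3 * (z + PI)) with (3 * z + PI + PI + PI) by ring. rewrite !TP. ring.
- intros z. replace (3 * (z + PI * (3 * sigma))) with (3 * z + PI * (9 * sigma)) by ring. rewrite TO.
  replace (- (PI * Ci * (9 * sigma))) with (- (9 * (PI * Ci * sigma))) by ring.
  replace (- (2 * INR 1 * Ci * (3 * z))) with (- (2 * INR 3 * Ci * z)); [reflexivity|].
  simpl INR. rewrite !RtoC_plus. ring.
Qed.

Lemma theta_prod_cube sigma : (0 < Im sigma)%R ->
  theta_fun 3 (3 * sigma) (- Cexp (- (9 * (PI * Ci * sigma)))) (fun z => theta_prod (3 * sigma) z ^ 3).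
Proof.
intros H. assert (H3 : (0 < Im (3 * sigma))%R) by (destruct sigma; simpl in *; lra).
destruct (theta_prod_theta_fun (3 * sigma) H3) as [TE TP TO]. split.
- auto using entire_pow.
- intros z. rewrite TP. ring.
- intros z. rewrite TO.
  transitivity (- (Cexp (- (PI * Ci * (3 * sigma))) ^ 3 * Cexp (- (2 * INR 1 * Ci * z)) ^ 3)
    * theta_prod (3 * sigma) z ^ 3); [ring|].
  transitivity (- (Cexp (- (9 * (PI * Ci * sigma))) * Cexp (- (2 * INR 3 * Ci * z)))
    * theta_prod (3 * sigma) z ^ 3); [|ring].
  rewrite !Cexp_pow, <- !Cexp_plus. do 3 f_equal. simpl INR. rewrite !RtoC_plus. ring.
Qed.

Lemma Cmult_integral_r (a b : C) : a * b = 0 -> b <> 0 -> a = 0.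
Proof.
intros E Hb. rewrite <- (Cmult_1_r a), <- (Cinv_r b Hb), Cmult_assoc, E. ring.
Qed.

(** In the linear relation between the three odd functions of order 3 the
    coefficient of theta_prod (9 sigma) (3 z) is not zero: otherwise, since the cube
    vanishes to third order at 0 and theta_prod sigma does not, the other two
    coefficients would vanish as well. *)
Lemma theta_prod_relation sigma : (0 < Im sigma)%R ->
  exists a b : C, forall z,
    theta_prod (9 * sigma) (3 * z) = a * theta_prod sigma z + b * theta_prod (3 * sigma) z ^ 3.
Proof.
intros H. assert (H3 : (0 < Im (3 * sigma))%R) by (destruct sigma; simpl in *; lra).
destruct (odd_theta_fun_3_dependent (3 * sigma) (- Cexp (- (9 * (PI * Ci * sigma))))
  (fun z => theta_prod (9 * sigma) (3 * z)) (theta_prod sigma) (fun z => theta_prod (3 * sigma) z ^ 3))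
  as [l1 [l2 [l3 [Hl R]]]].
- intros E. apply (Cexp_neq0 (- (9 * (PI * Ci * sigma)))).
  replace (Cexp (- (9 * (PI * Ci * sigma)))) with (- - Cexp (- (9 * (PI * Ci * sigma)))) by ring.
  rewrite E. ring.
- now apply theta_prod_3z.
- now apply theta_prod_triple.
- now apply theta_prod_cube.
- intros z. replace (3 * - z) with (- (3 * z)) by ring. apply theta_prod_opp.
- apply theta_prod_opp.
- intros z. rewrite theta_prod_opp. ring.
- assert (L1 : l1 <> 0).
  { intros E1. subst l1.
    assert (E2 : l2 = 0).
    { apply (Cmult_integral_r l2 (theta_cofactor sigma 0)); [|now apply theta_cofactor_0_neq0].
      assert (D := Csin_quotient_at_0 0 (fun _ => 0)
        (fun z => l2 * theta_cofactor sigma z + l3 * (Csin z ^ 2 * theta_cofactor (3 * sigma) z ^ 3))).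
      cbv beta in D. rewrite Cmult_0_r in D.
      assert (S0 : Csin 0 = 0).
      { rewrite Csin_factor. replace (2 * Ci * 0) with (RtoC 0) by ring. rewrite Cexp_0. ring. }
      rewrite S0 in D.
      replace (l2 * theta_cofactor sigma 0)
        with (l2 * theta_cofactor sigma 0 + l3 * (0 ^ 2 * theta_cofactor (3 * sigma) 0 ^ 3)) by (simpl; ring).
      symmetry. apply D.
      - apply entire_const.
      - apply entire_plus; apply entire_scal; [now apply entire_theta_cofactor|].
        apply entire_mult; apply entire_pow; [apply entire_Csin | now apply entire_theta_cofactor].
      - intros z. specialize (R z). unfold theta_prod in R.
        transitivity (0 * (Csin (3 * z) * theta_cofactor (9 * sigma) (3 * z))
          + l2 * (Csin z * theta_cofactor sigma z) + l3 * (Csin z * theta_cofactor (3 * sigma) z) ^ 3);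
          [rewrite R; ring | simpl; ring]. }
    assert (E3 : l3 = 0).
    { apply (Cmult_integral_r l3 (theta_prod (3 * sigma) (PI / 2) ^ 3)).
      - specialize (R (PI / 2)). rewrite E2 in R. rewrite <- R. ring.
      - now apply Cpow_nz, theta_prod_PI2_neq0. }
    tauto. }
  exists (- l2 / l1), (- l3 / l1). intros z. specialize (R z).
  transitivity ((l1 * theta_prod (9 * sigma) (3 * z) + l2 * theta_prod sigma z
    + l3 * theta_prod (3 * sigma) z ^ 3) / l1
    + - l2 / l1 * theta_prod sigma z + - l3 / l1 * theta_prod (3 * sigma) z ^ 3).
  + field. exact L1.
  + rewrite R. field. exact L1.
Qed.

(** The coefficients a and b of the relation are eliminated by comparing first
    order terms at 0 and values at pi/2. *)
Lemma theta_prod_cubic sigma A z : (0 < Im sigma)%R ->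
  A * theta_prod (9 * sigma) (PI / 2) * theta_cofactor sigma 0
    = 3 * theta_cofactor (9 * sigma) 0 * theta_prod sigma (PI / 2) ->
  theta_prod (9 * sigma) (3 * z) * theta_prod (3 * sigma) (PI / 2) ^ 3 * theta_prod sigma (PI / 2)
  = A * theta_prod sigma z * theta_prod (9 * sigma) (PI / 2) * theta_prod (3 * sigma) (PI / 2) ^ 3
    - (A + 1) * theta_prod (3 * sigma) z ^ 3 * theta_prod (9 * sigma) (PI / 2) * theta_prod sigma (PI / 2).
Proof.
intros H HA.
assert (H3 : (0 < Im (3 * sigma))%R) by (destruct sigma; simpl in *; lra).
assert (H9 : (0 < Im (9 * sigma))%R) by (destruct sigma; simpl in *; lra).
destruct (theta_prod_relation sigma H) as [a [b R]].
assert (D0 : 3 * theta_cofactor (9 * sigma) 0 = a * theta_cofactor sigma 0).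
{ assert (D := Csin_quotient_at_0 3 (fun z => theta_cofactor (9 * sigma) (3 * z))
    (fun z => a * theta_cofactor sigma z + b * (Csin z ^ 2 * theta_cofactor (3 * sigma) z ^ 3))).
  cbv beta in D. replace (3 * 0) with (RtoC 0) in D by ring.
  assert (S0 : Csin 0 = 0).
  { rewrite Csin_factor. replace (2 * Ci * 0) with (RtoC 0) by ring. rewrite Cexp_0. ring. }
  rewrite S0 in D. rewrite D; [simpl; ring | | | ].
  - apply (entire_comp (theta_cofactor (9 * sigma))); [now apply entire_theta_cofactor|].
    apply entire_scal, entire_id.
  - apply entire_plus; apply entire_scal; [now apply entire_theta_cofactor|].
    apply entire_mult; apply entire_pow; [apply entire_Csin | now apply entire_theta_cofactor].
  - intros y. specialize (R y). unfold theta_prod in R. rewrite R. simpl. ring. }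
assert (V : - theta_prod (9 * sigma) (PI / 2)
  = a * theta_prod sigma (PI / 2) + b * theta_prod (3 * sigma) (PI / 2) ^ 3).
{ rewrite <- R. replace (3 * (PI / 2)) with (PI / 2 + PI) by field.
  symmetry. apply (tf_pi _ _ _ _ (theta_prod_theta_fun _ H9)). }
assert (Aa : A * theta_prod (9 * sigma) (PI / 2) = a * theta_prod sigma (PI / 2)).
{ assert (N := theta_cofactor_0_neq0 sigma H).
  rewrite <- (Cmult_1_r (A * _)), <- (Cinv_r _ N), Cmult_assoc, HA, D0. field. exact N. }
rewrite R.
set (c9 := theta_prod (9 * sigma) (PI / 2)) in *. set (c1 := theta_prod sigma (PI / 2)) in *.
set (c3 := theta_prod (3 * sigma) (PI / 2)) in *.
set (f2 := theta_prod sigma z). set (f3 := theta_prod (3 * sigma) z).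
transitivity ((A * c9) * f2 * c3 ^ 3 - (A * c9 + c9) * f3 ^ 3 * c1); [|ring].
rewrite Aa. replace c9 with (- - c9) by ring. rewrite V. ring.
Qed.

Theorem theorem2 (tau z : C) (Htau : (0 < Im tau)%R) :
  let tau' := - (1) / tau in
  theta1 (3 * z) tau' * theta1 (PI / 2) (tau' / 3) ^ 3 * theta1 (PI / 2) (tau' / 9)
  = 1 / 3 * (PiQ tau / PiQ (9 * tau))
      * theta1 z (tau' / 9) * theta1 (PI / 2) tau' * theta1 (PI / 2) (tau' / 3) ^ 3
    - (1 / 3 * (PiQ tau / PiQ (9 * tau)) + 1)
      * theta1 z (tau' / 3) ^ 3 * theta1 (PI / 2) tau' * theta1 (PI / 2) (tau' / 9).
Proof.
intros tau'. destruct (Im_neg_inv tau Htau) as [N H9]. fold tau' in H9.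
assert (Htau9 : (0 < Im (9 * tau))%R) by (destruct tau; simpl in *; lra).
destruct (Im_neg_inv (9 * tau) Htau9) as [N9 H1].
set (sigma := - (1) / (9 * tau)) in *.
assert (E9 : tau' = 9 * sigma) by (unfold tau', sigma; field; exact N).
assert (E3 : tau' / 3 = 3 * sigma) by (rewrite E9; field).
assert (E1 : tau' / 9 = sigma) by (rewrite E9; field).
rewrite E3, E1, E9.
assert (H3 : (0 < Im (3 * sigma))%R) by (destruct sigma; simpl in *; lra).
rewrite E9 in H9.
assert (M9 := theta_cofactor_modular tau Htau). fold tau' in M9. rewrite E9 in M9.
assert (M1 := theta_cofactor_modular (9 * tau) Htau9). fold sigma in M1.
destruct (theta1_prod sigma H1) as [k1 T1].
destruct (theta1_prod (3 * sigma) H3) as [k3 T3].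
destruct (theta1_prod (9 * sigma) H9) as [k9 T9].
rewrite !T1, !T3, !T9.
set (A := 1 / 3 * (PiQ tau / PiQ (9 * tau))).
assert (C := theta_prod_cubic sigma A z H1).
assert (P := PiQ_neq0 (9 * tau) Htau9).
rewrite M1, M9 in C.
specialize (C ltac:(unfold A; field; exact P)).
transitivity (k9 * k3 ^ 3 * k1 * (theta_prod (9 * sigma) (3 * z) * theta_prod (3 * sigma) (PI / 2) ^ 3
  * theta_prod sigma (PI / 2))); [ring|].
rewrite C. ring.
Qed.
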